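(* Let $p, n, s \in \mathbb{N}$ with $1 \leq s \leq p$ and $\log\left(1 + \frac{p}{s^2}\right) \leq \frac{n}{2}$. Define $$\psi(p,s,n)^2 := \begin{cases} \frac{s \log\left(1+\frac{p}{s^2}\right)}{n} \vee s\,\Gamma_{\mathcal{H}} & \text{if } s < \sqrt{p}, \\ s\,\Gamma_{\mathcal{H}} & \text{if } s \geq \sqrt{p}, \end{cases} \qquad \Gamma_{\mathcal{H}} := \max_{\nu \in \mathbb{N}} \left\{ \mu_\nu \wedge \frac{\sqrt{\nu \log\left(1+\frac{p}{s^2}\right)}}{n}\right\}.$$ If $\eta \in (0,1)$, then there exists $c_\eta > 0$ depending only on $\eta$ such that for any $0 < c < c_\eta$ we have $$\inf_{\varphi}\left\{ P_0\{\varphi \neq 0\} + \sup_{\substack{f \in \mathcal{F}_s, \\ \|f\|_2 \geq c\,\psi(p,s,n)}} P_f\{\varphi \neq 1\}\right\} \geq 1-\eta.$$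
   Context: Notation: $[p]=\{1,\dots,p\}$, $a\vee b=\max\{a,b\}$, $a\wedge b=\min\{a,b\}$. Model: one observes the $p$-dimensional Gaussian white noise model $dY_x = f(x)\,dx + \frac{1}{\sqrt n}\,dB_x$, $x\in[0,1]^p$. $P_f$ denotes the law of the observation when the signal is $f$, and $P_0$ the law when $f\equiv 0$. The infimum is over all tests $\varphi$, i.e. measurable functions of the observation with values in $\{0,1\}$. $\|\cdot\|_2$ is the $L^2([0,1]^p)$ norm. Function space: $\mathcal{H}\subset L^2([0,1])$ is a reproducing kernel Hilbert space (RKHS) whose kernel admits a Mercer expansion. Let $\mathbf 1$ be the constant function one and $\mathcal{H}_0 := \mathcal{H}\cap \mathrm{span}\{\mathbf 1\}^\perp$ (orthogonality in $L^2([0,1])$), also an RKHS, with eigenfunctions $\{\psi_k\}_{k\ge1}$ orthonormal in $L^2([0,1])$ and corresponding eigenvalues $\mu_1\ge\mu_2\ge\dots\ge0$ in the Mercer expansion of its kernel, so that $\|g\|_{\mathcal{H}_0}^2=\sum_{k\ge1}\mu_k^{-1}\langle g,\psi_k\rangle_{L^2}^2$. It is assumed that $\mu_1=1$. Parameter space: for $S\subset[p]$, $\mathcal{H}_S := \{f(x)=\sum_{j\in S} f_j(x_j): f_j\in\mathcal{H}_0,\ \|f_j\|_{\mathcal{H}_0}\le 1 \text{ for all } j\in S\}$, and $\mathcal{F}_s := \bigcup_{S\subset[p],\,|S|\le s}\mathcal{H}_S$. *)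

(* Defs.v *)
From HB Require Import structures.
From mathcomp Require Import all_boot all_order all_algebra.
From mathcomp Require Import all_classical all_reals all_analysis.

Set Implicit Arguments.
Unset Strict Implicit.
Unset Printing Implicit Defensive.

Import Order.TTheory GRing.Theory Num.Theory.
Import numFieldNormedType.Exports.

Local Open Scope classical_set_scope.
Local Open Scope ring_scope.

Section power_probability.
Context d (T : measurableType d) (R : realType).

Definition tcons n (z : T * n.-tuple T) : n.+1.-tuple T :=
  [the n.+1.-tuple T of z.1 :: z.2].

Lemma measurable_tcons n : measurable_fun [set: T * n.-tuple T] (@tcons n).
Proof. exact: measurable_cons measurable_fst measurable_snd. Qed.

HB.instance Definition _ n :=
  isMeasurableFun.Build _ _ _ _ (@tcons n) (@measurable_tcons n).

(* The n-fold product measure P \x ... \x P on n.-tuple T. *)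
Fixpoint power_prob (P : probability T R) n : probability (n.-tuple T) R :=
  match n with
  | 0 => dirac [tuple]
  | m.+1 => distribution (P \x power_prob P m)%E (@tcons m)
  end.

End power_probability.

Section function_spaces.
Context (R : realType).

(* Lebesgue measure on [0,1], seen as a probability on R (density 1 on [0,1]).
   A function on [0,1] is a function R -> R whose values outside [0,1] are
   irrelevant to every integral against this measure. *)
Definition unit_leb : probability (measurableTypeR R) R :=
  uniform_prob (@ltr01 R).

Definition unit_cube_leb p := power_prob unit_leb p.

Definition in_unit (x : R) : bool := 0 <= x <= 1.

Definition in_cube p (x : p.-tuple R) : bool := all in_unit x.

Definition L2dot (g h : R -> R) : R := \int[unit_leb]_x (g x * h x).

Definition L2_orthonormal (phi : nat -> R -> R) : Prop :=
  (forall k, phi k \in Lfun unit_leb 2%:E) /\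
  (forall j k, L2dot (phi j) (phi k) = (j == k)%:R).

Definition dnorm (dot : (R -> R) -> (R -> R) -> R) (h : R -> R) : R :=
  Num.sqrt (dot h h).

(* H, with inner product dot, is a Hilbert space of functions on [0,1] with
   reproducing kernel K. So that equality in H is equality of functions on
   [0,1], elements of H are represented by their extension by zero to R. *)
Record is_rkhs (H : set (R -> R)) (dot : (R -> R) -> (R -> R) -> R)
    (K : R -> R -> R) : Prop := IsRKHS {
  rkhs_supp : forall h x, H h -> ~~ in_unit x -> h x = 0 ;
  rkhs_zero : H (fun=> 0) ;
  rkhs_lin : forall a g h, H g -> H h -> H (fun x => a * g x + h x) ;
  rkhs_dotC : forall g h, H g -> H h -> dot g h = dot h g ;
  rkhs_dot_lin : forall a f g h, H f -> H g -> H h ->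
    dot (fun x => a * f x + g x) h = a * dot f h + dot g h ;
  rkhs_dot_gt0 : forall h, H h -> h <> (fun=> 0) -> 0 < dot h h ;
  rkhs_complete : forall u : nat -> R -> R, (forall i, H (u i)) ->
    (forall e : R, 0 < e -> exists N : nat, forall i j : nat,
      (N <= i)%N -> (N <= j)%N -> dnorm dot (u i \- u j) < e) ->
    exists2 h, H h & (fun i => dnorm dot (u i \- h)) @ \oo --> (0 : R) ;
  rkhs_kernel : forall x, in_unit x -> H (K x) ;
  rkhs_reproducing : forall h x, H h -> in_unit x -> dot h (K x) = h x }.

(* Sequences are indexed from 0: mu k and psi k are the (k+1)-st eigenvalue and
   eigenfunction. Vanishing eigenvalues are allowed, which covers kernels of
   finite rank. If K is the kernel of an RKHS with inner product dot, then
   dot h h = \sum_(k | mu k != 0) (L2dot h (psi k))^2 / mu k follows. *)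
Definition mercer_expansion (K : R -> R -> R) (mu : nat -> R)
    (psi : nat -> R -> R) : Prop :=
  [/\ L2_orthonormal psi,
      forall k, 0 <= mu k,
      forall k, mu k.+1 <= mu k &
      forall x y, in_unit x -> in_unit y ->
        series (fun k => mu k * psi k x * psi k y) @ \oo --> K x y].

Definition centered (H : set (R -> R)) : set (R -> R) :=
  [set h | H h /\ L2dot h (fun=> 1) = 0].

Definition additive_class (H0 : set (R -> R))
    (dot : (R -> R) -> (R -> R) -> R) p (S : {set 'I_p}) :
    set (p.-tuple R -> R) :=
  [set f | exists2 g : 'I_p -> R -> R,
    forall j, j \in S -> H0 (g j) /\ dnorm dot (g j) <= 1 &
    f = fun x => \sum_(j in S) g j (tnth x j)].

Definition sparse_additive_class H0 dot p s : set (p.-tuple R -> R) :=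
  \bigcup_(S in [set S : {set 'I_p} | (#|S| <= s)%N]) additive_class H0 dot S.

End function_spaces.

Section white_noise.
Context (R : realType).

Definition std_normal : probability (measurableTypeR R) R :=
  normal_prob (0 : R) 1.

Definition mx_act m k (A : 'M[R]_(m, k)) (z : k.-tuple R) : m.-tuple R :=
  [tuple \sum_(j < k) A i j * tnth z j | i < m].

(* X ~ N(0, Sigma), i.e. X has the law of A Z, where A A^T = Sigma and the
   entries of Z are i.i.d. N(0, 1). Sigma may be singular. *)
Definition centered_gaussian d (Omega : measurableType d)
    (P : probability Omega R) m (X : Omega -> m.-tuple R)
    (Sigma : 'M[R]_m) : Prop :=
  exists k (A : 'M[R]_(m, k)), A *m A^T = Sigma /\
    forall D : set (m.-tuple R), measurable D ->
      P (X @^-1` D) = power_prob std_normal k (mx_act A @^-1` D).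

Definition brownian_sheet d (Omega : measurableType d)
    (P : probability Omega R) p (B : p.-tuple R -> Omega -> R) : Prop :=
  (forall x, in_cube x -> measurable_fun setT (B x)) /\
  (forall m (x : 'I_m -> p.-tuple R), (forall i, in_cube (x i)) ->
    centered_gaussian P (fun w => [tuple B (x i) w | i < m])
      (\matrix_(i, j) \prod_(l < p) Num.min (tnth (x i) l) (tnth (x j) l))).

(* Observed paths x |-> Y_x, with the sigma-algebra generated by the
   evaluations at the points of the unit cube. *)
Definition cylinders p : set (set (p.-tuple R -> R)) :=
  [set A | exists2 x : p.-tuple R, in_cube x &
    exists2 D : set R, measurable D & A = [set y | D (y x)]].

Definition path_space p := g_sigma_algebraType (@cylinders p).

(* dY_x = f(x) dx + n^{-1/2} dB_x in integrated form:
   Y_x = \int_{[0, x]} f + n^{-1/2} B_x. *)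
Definition observation (Omega : Type) p (B : p.-tuple R -> Omega -> R) n
    (f : p.-tuple R -> R) (w : Omega) : path_space p :=
  fun x => \int[unit_cube_leb R p]_(u in [set u | forall j,
             tnth u j <= tnth x j]) f u
           + (Num.sqrt n%:R)^-1 * B x w.

Definition law d (Omega : measurableType d) (P : probability Omega R) p
    (B : p.-tuple R -> Omega -> R) n (f : p.-tuple R -> R) :
    set (path_space p) -> \bar R :=
  pushforward P (observation B n f).

Definition minimax_testing_risk d (Omega : measurableType d)
    (P : probability Omega R) p (B : p.-tuple R -> Omega -> R) n
    (alt : set (p.-tuple R -> R)) : \bar R :=
  ereal_inf [set (law P B n (fun=> 0%R) [set y | phi y != false]
      + ereal_sup [set law P B n f [set y | phi y != true] | f in alt])%E
    | phi in [set: {mfun path_space p >-> bool}]].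

End white_noise.

Section rate.
Context (R : realType) (mu : nat -> R) (p s n : nat).

Definition log_term : R := ln (1 + p%:R / s%:R ^+ 2).

(* The supremum is a maximum: mu is nonincreasing, and the second term is
   increasing and unbounded in nu = k.+1. *)
Definition Gamma : R :=
  sup (range (fun k => Num.min (mu k)
                               (Num.sqrt (k.+1%:R * log_term) / n%:R))).

Definition rate_sq : R :=
  if s%:R < Num.sqrt (p%:R : R)
  then Num.max (s%:R * log_term / n%:R) (s%:R * Gamma)
  else s%:R * Gamma.

Definition rate : R := Num.sqrt rate_sq.

End rate.

(* Main.v *)
Require Import Defs.
From HB Require Import structures.
From mathcomp Require Import all_boot all_order all_algebra.
From mathcomp Require Import all_classical all_reals all_analysis.
From mathcomp Require Import measurable_realfun.
From mathcomp Require Import ring lra.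

Set Implicit Arguments.
Unset Strict Implicit.
Unset Printing Implicit Defensive.

Import Order.TTheory GRing.Theory Num.Theory.
Import numFieldNormedType.Exports.

Local Open Scope classical_set_scope.
Local Open Scope ring_scope.

(** The lower bound is a second moment argument in the style of Ingster.  If a
    uniform mixture of finitely many alternatives [f_i] has a likelihood ratio
    whose second moment under the null hypothesis is at most [1 + eta ^+ 2],
    then no event separates the mixture from the null hypothesis by more than
    [eta], and the risk of every test is at least [1 - eta].  In white noise of
    level [n^(-1/2)] that second moment is the average of
    [expR (n * <f_i, f_j>)] over all pairs (i, j).

    Prior.  Cut [p] coordinates into [s] blocks of [m = p %/ s].  In each block,
    independently, one active coordinate is drawn uniformly, with [nu] random
    signs, and the signal is the sum over the blocks of
    [alpha * \sum_(k < nu) (+-1) psi_k], evaluated at the active coordinate.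
    Two draws interact only in the blocks where their active coordinates agree,
    which happens with probability [1 / m <= 2 s / p].  By independence the
    second moment is
    [(1 + (cosh (n alpha ^+ 2) ^+ nu - 1) / m) ^+ s] ([sum_expR_config]), and it
    is at most [1 + eta ^+ 2] as soon as [cosh (n alpha ^+ 2) ^+ nu] is at most
    [(1 + p / s ^+ 2) ^ (eta ^+ 2 / 4)] ([overlap_mgf_le]).  Drawing one
    coordinate per block instead of a uniform subset of size [s] is what makes
    this computation a product.  Two choices of [nu] and [alpha] give the two
    terms of the rate: with [nu] nearly optimal in the definition of [Gamma],
    [cosh b <= expR (2 b ^+ 2)] gives [s * Gamma]; with [nu = 1],
    [cosh b <= expR b] gives [s * log (1 + p / s ^+ 2) / n].

    Membership.  The eigenfunctions are only given through the pointwise Mercer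
    expansion, so that a finite combination of them has to be shown to lie in
    the unit ball of the space ([mercer_unit_ball]).  This is a Riesz argument:
    a functional of norm at most one on the span of the kernel sections is
    represented by an element of the unit ball, obtained from completeness as
    the limit of a minimising sequence ([rkhs_unit_ball]).

    From paths to vectors.  The observation is a random path, and nothing is
    known of the noise beyond its finite-dimensional laws.  Every event of the
    path space is approximated, under the null and all the [f_i] at once, by an
    event that depends on finitely many points ([test_from_algebra]).  There the
    observation is a linear image of a standard Gaussian vector, shifted by the
    inner products of the signal with indicators of boxes.  These shifts come
    from the projections of the signals on the span of the indicators
    ([projection_coordinates]), the Cameron-Martin formula
    ([ge0_integral_power_normal_shift]) provides the likelihood ratios, and the
    second moment of the projected experiment is bounded by that of the full
    one because entrywise exponentials preserve the order of Gram matrices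
    ([sum_expR_leD]). *)

(** * The overlap of two random configurations *)

(** For [b <= 1], [cosh b = 1 + 2 * sinh (b / 2) ^+ 2], and
    [1 - x <= expR (- x)] at [x = b / 2] bounds this hyperbolic sine by [b].
    For larger [b] already [expR b] is below the right-hand side. *)
Lemma cosh_le_expR2 (R : realType) (b : R) : 0 <= b ->
  (expR b + expR (- b)) / 2 <= expR (2 * b ^+ 2).
Proof.
move=> b0; have [b1|b1] := leP b 1; last first.
  have h1 : expR (- b) <= expR b by rewrite ler_expR; lra.
  have : expR b <= expR (2 * b ^+ 2) by rewrite ler_expR; nra.
  by move: h1; set x := expR b; set y := expR _; set z := expR _; lra.
set x := expR (b / 2).
have x1 : 1 - b / 2 <= x^-1.
  by rewrite -expRN; have := expR_ge1Dx (- (b / 2)); lra.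
have xE : expR b = x ^+ 2 by rewrite -expRM_natl; congr expR; field.
rewrite expRN xE.
have x_ge1 : 1 <= x by rewrite -[leLHS]expR0 ler_expR; lra.
have x2 : x * (1 - b / 2) <= 1.
  have x0 : 0 < x by exact: expR_gt0.
  by rewrite -[leRHS](mulfV (lt0r_neq0 x0)) ler_pM2l.
have sb : x - x^-1 <= 2 * b.
  have x_le2 : x <= 2 by nra.
  have : x - x^-1 <= x - (1 - b / 2) by lra.
  nra.
have s0 : 0 <= x - x^-1.
  by rewrite subr_ge0 (le_trans _ x_ge1)// invf_le1//; lra.
have E : (x ^+ 2 + (x ^+ 2)^-1) / 2 = 1 + (x - x^-1) ^+ 2 / 2.
  by field; lra.
rewrite E; apply: le_trans (expR_ge1Dx _); nra.
Qed.

Lemma expR_mul_le (R : realType) (e x : R) : 0 <= e <= 1 ->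
  expR (e * x) <= 1 + e * (expR x - 1).
Proof.
move=> /andP[e0 e1]; have := convex_expR (Itv01 e0 e1) x 0.
rewrite !convRE /= expR0 mulr0 addr0 mulr1 /unstable.onem; lra.
Qed.

(** The left-hand side is the exponential moment of the number of agreements of
    two draws, each block agreeing with probability [1 / m].  By convexity
    [expR lam - 1] is at most [eta ^+ 2 / 4 * (p / s ^+ 2)], and dividing by [m]
    cancels [p / s] up to a factor 2, so that the power is at most
    [expR (eta ^+ 2 / 2)]. *)
Lemma overlap_mgf_le (R : realType) (p s m : nat) (eta lam : R) :
  0 < eta < 1 -> (0 < s)%N -> (0 < m)%N -> (p <= 2 * s * m)%N ->
  lam <= eta ^+ 2 / 4 * log_term R p s ->
  (1 + (expR lam - 1) / m%:R) ^+ s <= 1 + eta ^+ 2.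
Proof.
move=> eta01 s0 m0 psm lamle.
set e := eta ^+ 2 / 4 in lamle.
have e01 : 0 <= e <= 1 by rewrite /e; apply/andP; split; nra.
have s0R : (0 : R) < s%:R by rewrite ltr0n.
have m0R : (0 : R) < m%:R by rewrite ltr0n.
have psmR : (p%:R : R) <= 2 * s%:R * m%:R by rewrite -!natrM ler_nat.
have expL : expR (log_term R p s) = 1 + p%:R / s%:R ^+ 2.
  by rewrite /log_term lnK// posrE ltr_pwDl//.
have h : expR lam - 1 <= e * (p%:R / s%:R ^+ 2).
  have := le_trans _ (expR_mul_le (log_term R p s) e01).
  move=> /(_ (expR lam)); rewrite ler_expR => /(_ lamle); rewrite expL; lra.
have h2 : (expR lam - 1) / m%:R <= 2 * e / s%:R.
  rewrite ler_pdivrMr//; apply: (le_trans h).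
  rewrite mulrA ler_pdivrMr ?exprn_gt0//.
  rewrite [leRHS](_ : _ = e * (2 * s%:R * m%:R)); last by field; lra.
  by apply: ler_wpM2l; lra.
apply: (@le_trans _ _ (expR (2 * e / s%:R) ^+ s)).
  apply: lerXn2r; rewrite ?nnegrE ?expR_ge0//.
    have : -1 <= (expR lam - 1) / m%:R; last lra.
    rewrite ler_pdivlMr// mulN1r.
    have : (1 : R) <= m%:R by rewrite ler1n.
    by have := expR_gt0 lam; lra.
  by apply: le_trans (expR_ge1Dx _); lra.
rewrite -expRM_natl mulrCA mulfV ?lt0r_neq0// mulr1.
have : 1 - 2 * e <= (expR (2 * e))^-1.
  by rewrite -expRN; have := expR_ge1Dx (- (2 * e)); lra.
have y0 := expR_gt0 (2 * e); set y := expR _ in y0 * => hy.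
have : y * (1 - 2 * e) <= 1 by rewrite -[leRHS](mulfV (lt0r_neq0 y0)) ler_pM2l.
have t01 : 0 < eta ^+ 2 < 1 by apply/andP; split; nra.
rewrite /e => hy2; rewrite -(@ler_pM2r _ (1 - eta ^+ 2 / 2)); last by lra.
apply: (@le_trans _ _ 1); first by rewrite (le_trans _ hy2)// ler_pM2l; lra.
by move: t01; set u := eta ^+ 2; nra.
Qed.

Section prior.
Context (R : realType) (s m nu : nat).

(** One block of the random signal: which of the [m] coordinates of the block
    is active, and the signs of the [nu] coefficients there. *)
Definition block := ('I_m * {ffun 'I_nu -> bool})%type.

Definition block_dot (x y : block) : R :=
  (x.1 == y.1)%:R * \sum_(k < nu) (-1) ^+ (x.2 k) * (-1) ^+ (y.2 k).

Definition config := {ffun 'I_s -> block}.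

Definition config_dot (v w : config) : R := \sum_(b < s) block_dot (v b) (w b).

Lemma sum_expR_signs (b : R) (e : {ffun 'I_nu -> bool}) :
  \sum_(e' : {ffun 'I_nu -> bool})
    expR (b * \sum_(k < nu) (-1) ^+ (e k) * (-1) ^+ (e' k)) =
  (expR b + expR (- b)) ^+ nu.
Proof.
transitivity (\prod_(k < nu) \sum_(x : bool)
    expR (b * ((-1) ^+ (e k) * (-1) ^+ x))).
  rewrite bigA_distr_bigA/=; apply: eq_bigr => e' _.
  by rewrite mulr_sumr expR_sum.
transitivity (\prod_(k < nu) (expR b + expR (- b))); last first.
  by rewrite prodr_const card_ord.
apply: eq_bigr => k _; rewrite big_bool /=.
by case: (e k); rewrite /= ?expr0 ?expr1 ?mulrNN ?mulr1 ?mul1r ?mulrN1// addrC.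
Qed.

Lemma sum_expR_block (b : R) (x : block) :
  \sum_(y : block) expR (b * block_dot x y) =
  (m%:R - 1) * 2 ^+ nu + (expR b + expR (- b)) ^+ nu.
Proof.
rewrite -(pair_bigA_idem _ (fun i e => expR (b * block_dot x (i, e))))/=
  ?addr0//.
rewrite (bigD1 x.1)//= addrC; congr (_ + _).
  transitivity (\sum_(i < m | i != x.1) (2 ^+ nu : R)).
    apply: eq_bigr => i ix.
    transitivity (\sum_(j : {ffun 'I_nu -> bool}) (1 : R)).
      apply: eq_bigr => e _.
      by rewrite /block_dot /= eq_sym (negbTE ix) mul0r mulr0 expR0.
    by rewrite sumr_const card_ffun card_bool card_ord -natrX.
  rewrite sumr_const -[LHS]mulr_natl.
  have := cardC (pred1 x.1); rewrite card1 card_ord.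
  move=> /(congr1 (fun n => n%:R : R)); rewrite natrD => <-.
  congr (_ * _); rewrite addrAC subrr add0r.
  by congr (_%:R); apply: eq_card => i.
rewrite -(sum_expR_signs b x.2); apply: eq_bigr => e _.
by rewrite /block_dot/= eqxx mul1r.
Qed.

(** The exponential of the overlap is a product over the blocks, so that the sum
    of products is a product of sums, none of which depends on the first
    draw. *)
Lemma sum_expR_config (b : R) (v : config) :
  \sum_(w : config) expR (b * config_dot v w) =
  ((m%:R - 1) * 2 ^+ nu + (expR b + expR (- b)) ^+ nu) ^+ s.
Proof.
transitivity (\prod_(i < s) \sum_(y : block) expR (b * block_dot (v i) y)).
  rewrite bigA_distr_bigA/=; apply: eq_bigr => w _.
  by rewrite /config_dot mulr_sumr expR_sum.
transitivity (\prod_(i < s)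
    ((m%:R - 1) * 2 ^+ nu + (expR b + expR (- b)) ^+ nu : R)).
  by apply: eq_bigr => i _; rewrite sum_expR_block.
by rewrite prodr_const card_ord.
Qed.

Lemma card_config :
  (#|{: config}|%:R : R) = (m%:R * 2 ^+ nu) ^+ s.
Proof.
by rewrite card_ffun card_prod card_ffun card_bool !card_ord
  natrX natrM natrX.
Qed.

Lemma sum_expR_config_le (p : nat) (eta lam b : R) :
  0 < eta < 1 -> (0 < s)%N -> (0 < m)%N -> (p <= 2 * s * m)%N ->
  ((expR b + expR (- b)) / 2) ^+ nu <= expR lam ->
  lam <= eta ^+ 2 / 4 * log_term R p s ->
  forall v : config, \sum_(w : config) expR (b * config_dot v w) <=
  (1 + eta ^+ 2) * #|{: config}|%:R.
Proof.
move=> eta01 s0 m0 psm coshle lamle v.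
rewrite sum_expR_config card_config//.
have := overlap_mgf_le eta01 s0 m0 psm lamle.
have m0R : (0 : R) < m%:R by rewrite ltr0n.
have m1R : (1 : R) <= m%:R by rewrite ler1n.
have two0 : (0 : R) < 2 ^+ nu by rewrite exprn_gt0.
have N0 : (0 : R) < (m%:R * 2 ^+ nu) by rewrite mulr_gt0.
rewrite -(ler_pM2r (exprn_gt0 s N0)) => /(le_trans _); apply.
rewrite -exprMn; apply: lerXn2r; rewrite ?nnegrE.
- rewrite addr_ge0 ?mulr_ge0 ?subr_ge0 ?exprn_ge0 ?addr_ge0 ?expR_ge0//.
- rewrite mulr_ge0 ?ltW// -(@pmulr_lgt0 _ m%:R)//.
  rewrite mulrDl mul1r divfK ?lt0r_neq0//.
  by have := expR_gt0 lam; lra.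
- rewrite (_ : (1 + (expR lam - 1) / m%:R) * (m%:R * 2 ^+ nu) =
    (m%:R - 1) * 2 ^+ nu + expR lam * 2 ^+ nu); last by field; lra.
  by rewrite lerD2l -ler_pdivrMr// -exprVn -exprMn.
Qed.

End prior.

(** * Mixtures of translates of the Gaussian measure *)

Section power_prob_integral.
Local Open Scope ereal_scope.
Context d (T : measurableType d) (R : realType) (P : probability T R).

Lemma ge0_integral_power_probS n (f : n.+1.-tuple T -> \bar R) :
  measurable_fun [set: n.+1.-tuple T] f -> (forall z, 0 <= f z) ->
  \int[power_prob P n.+1]_z f z =
  \int[P]_x \int[power_prob P n]_t f (tcons (x, t)).
Proof.
move=> mf f0.
rewrite [LHS]ge0_integral_distribution//=.
rewrite fubini_tonelli1//=.
by apply: measurableT_comp => //; exact: measurable_tcons.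
Qed.

Lemma measurable_section_power_prob n (f : n.+1.-tuple T -> \bar R) :
  measurable_fun [set: n.+1.-tuple T] f -> (forall z, 0 <= f z) ->
  measurable_fun setT (fun x => \int[power_prob P n]_t f (tcons (x, t))).
Proof.
move=> mf f0.
apply: (@measurable_fun_fubini_tonelli_F _ _ _ _ _ (power_prob P n)
  (f \o @tcons _ T n)) => [|z]; last exact: f0.
by apply: measurableT_comp => //; exact: measurable_tcons.
Qed.

End power_prob_integral.

Section gaussian_shift.
Context (R : realType).
Local Notation leb := (@lebesgue_measure R).

(** The normal density and the Radon-Nikodym derivative have the same integral
    over every measurable set, hence agree almost everywhere. *)
Lemma ge0_integral_std_normal (f : R -> \bar R) :
  measurable_fun setT f -> (forall x, 0 <= f x)%E ->
  (\int[std_normal R]_x f x =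
   \int[leb]_x (f x * (normal_pdf 0 1 x)%:E))%E.
Proof.
move=> mf f0.
have dom := normal_prob_dominates (0 : R) 1.
rewrite -(@Radon_Nikodym_SigmaFinite.change_of_variables _ _ _
  (std_normal R) leb dom f)//.
have mpdf : measurable_fun setT (EFin \o normal_pdf (0 : R) 1).
  by apply/measurable_EFinP; exact: measurable_normal_pdf.
have mf' := measurable_int _ (Radon_Nikodym_SigmaFinite.f_integrable dom).
apply: ge0_ae_eq_integral => //.
- by apply: emeasurable_funM.
- by apply: emeasurable_funM.
- by move=> x _; rewrite mule_ge0// Radon_Nikodym_SigmaFinite.f_ge0.
- by move=> x _; rewrite mule_ge0// lee_fin normal_pdf_ge0.
have := @integral_ae_eq _ _ _ leb setT measurableT _ _
  (Radon_Nikodym_SigmaFinite.f_integrable dom) mpdf.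
have h E : E `<=` setT -> measurable E ->
    (\int[leb]_(x in E) Radon_Nikodym_SigmaFinite.f (std_normal R) leb x =
     \int[leb]_(x in E) (EFin \o normal_pdf (0 : R) 1) x)%E.
  by move=> _ mE; rewrite -(Radon_Nikodym_SigmaFinite.f_integral dom mE).
by move=> /(_ h); apply: filterS => x /= H Dx; rewrite H.
Qed.

(** Translates of Lebesgue measure agree with it on intervals. *)
Lemma ge0_integral_lebesgue_shift (f : R -> \bar R) (u : R) :
  measurable_fun setT f -> (forall x, 0 <= f x)%E ->
  (\int[leb]_x f (x + u)%R = \int[leb]_x f x)%E.
Proof.
move=> mf f0.
pose phi : measurableTypeR R -> measurableTypeR R := fun x => x + u.
have mphi : measurable_fun setT phi by apply: measurable_funD.
have := @ge0_integral_pushforward _ _ (measurableTypeR R) (measurableTypeR R) R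
  phi mphi leb setT f measurableT mf (fun y _ => f0 y).
rewrite preimage_setT => <-.
apply: eq_measure_integral => /= A mA _; apply/esym.
apply: (@lebesgue_measure_unique R (pushforward leb phi)) => //= _ [[a b]] _ <-.
rewrite /pushforward /= (_ : phi @^-1` _ = `]a - u, b - u]%classic).
  rewrite !lebesgue_measure_itv/= !lte_fin ltrD2r.
  by case: ifP => // _; congr EFin; ring.
by apply/seteqP; split => x; rewrite /phi /= !in_itv/= ltrBlDr lerBrDr.
Qed.

Lemma normal_pdf_shift (u x : R) :
  normal_pdf 0 1 (x - u) = expR (u * x - u ^+ 2 / 2) * normal_pdf 0 1 x.
Proof.
rewrite !normal_pdfE ?oner_neq0// /normal_fun mulrCA; congr (_ * _).
by rewrite -expRD; congr expR; field.
Qed.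

Lemma ge0_integral_std_normal_shift (f : R -> \bar R) (u : R) :
  measurable_fun setT f -> (forall x, 0 <= f x)%E ->
  (\int[std_normal R]_x f (x + u)%R =
   \int[std_normal R]_x (f x * (expR (u * x - u ^+ 2 / 2))%:E))%E.
Proof.
move=> mf f0.
have mfu : measurable_fun setT (fun x : R => f (x + u)).
  by apply: (measurableT_comp mf); exact: measurable_funD.
have mg : measurable_fun setT
    (fun x => f x * (expR (u * x - u ^+ 2 / 2))%:E)%E.
  apply: emeasurable_funM => //; apply/measurable_EFinP.
  by apply: measurableT_comp => //; apply: measurable_funB => //.
have g0 (x : R) : (0 <= f x * (expR (u * x - u ^+ 2 / 2))%:E)%E.
  by rewrite mule_ge0// lee_fin expR_ge0.
rewrite ge0_integral_std_normal// ge0_integral_std_normal//.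
rewrite -[LHS](@ge0_integral_lebesgue_shift _ (- u)); last 2 first.
- apply: emeasurable_funM => //; apply/measurable_EFinP.
  exact: measurable_normal_pdf.
- by move=> x; rewrite mule_ge0// lee_fin normal_pdf_ge0.
apply: eq_integral => x _; rewrite -muleA -EFinM -normal_pdf_shift.
by rewrite addrNK.
Qed.

Definition vdot k (u : 'I_k -> R) (z : k.-tuple R) : R :=
  \sum_(i < k) u i * tnth z i.

Definition vdotf k (u v : 'I_k -> R) : R := \sum_(i < k) u i * v i.

Definition tshift k (u : 'I_k -> R) (z : k.-tuple R) : k.-tuple R :=
  [tuple tnth z i + u i | i < k].

Lemma measurable_vdot k (u : 'I_k -> R) :
  measurable_fun [set: k.-tuple R] (vdot u).
Proof.
apply: measurable_sum => i; apply: measurable_funM => //.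
exact: measurable_tnth.
Qed.

Lemma measurable_tshift k (u : 'I_k -> R) :
  measurable_fun [set: k.-tuple R] (tshift u).
Proof.
apply/measurable_fun_tnthP => i.
rewrite (_ : _ \o _ = (fun z => tnth z i + u i)).
  by apply: measurable_funD => //; exact: measurable_tnth.
by apply/funext => z /=; rewrite tnth_mktuple.
Qed.

(** The density, with respect to the standard Gaussian measure, of its
    translate by [u]. *)
Definition shift_density k (u : 'I_k -> R) (z : k.-tuple R) : R :=
  expR (vdot u z - vdotf u u / 2).

Lemma measurable_shift_density k (u : 'I_k -> R) :
  measurable_fun [set: k.-tuple R] (shift_density u).
Proof.
apply: measurableT_comp => //; apply: measurable_funB => //.
exact: measurable_vdot.
Qed.

Lemma tnth_tcons0 (T : Type) k (x : T) (t : k.-tuple T) :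
  tnth [tuple of x :: t] ord0 = x.
Proof. by []. Qed.

Lemma tnth_tconsS (T : Type) k (x : T) (t : k.-tuple T) i :
  tnth [tuple of x :: t] (lift ord0 i) = tnth t i.
Proof. by rewrite !(tnth_nth x). Qed.

(** The Cameron-Martin formula.  In dimension one it is the translation
    invariance of Lebesgue measure together with the form of the normal density;
    the induction on the dimension is Tonelli's theorem. *)
Lemma ge0_integral_power_normal_shift k (u : 'I_k -> R)
    (f : k.-tuple R -> \bar R) :
  measurable_fun [set: k.-tuple R] f -> (forall z, 0 <= f z)%E ->
  (\int[power_prob (std_normal R) k]_z f (tshift u z) =
   \int[power_prob (std_normal R) k]_z (f z * (shift_density u z)%:E))%E.
Proof.
elim: k u f => [|k IH] u f mf f0.
  apply: eq_integral => z _; rewrite /shift_density /vdot /vdotf !big_ord0.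
  rewrite mul0r subr0 expR0 mule1.
  by congr f; apply: eq_from_tnth => -[].
pose u' i := u (lift ord0 i).
have msh : measurable_fun [set: k.+1.-tuple R] (fun z => f (tshift u z)).
  by apply: (measurableT_comp mf); exact: measurable_tshift.
have mprod : measurable_fun [set: k.+1.-tuple R]
    (fun z => f z * (shift_density u z)%:E)%E.
  apply: emeasurable_funM => //; apply/measurable_EFinP.
  exact: measurable_shift_density.
have prod0 z : (0 <= f z * (shift_density u z)%:E)%E.
  by rewrite mule_ge0// lee_fin expR_ge0.
rewrite ge0_integral_power_probS// ge0_integral_power_probS//.
have mfx (x : R) : measurable_fun [set: k.-tuple R] (fun t => f (tcons (x, t))).
  apply: (measurableT_comp mf).
  apply: (measurableT_comp (@measurable_tcons _ _ _)).
  exact: measurable_pair1.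
transitivity (\int[std_normal R]_x
    \int[power_prob (std_normal R) k]_t
      (f (tcons ((x + u ord0)%R, t)) * (shift_density u' t)%:E))%E.
  apply: eq_integral => x _.
  rewrite -(IH u' (fun t => f (tcons ((x + u ord0)%R, t))))//.
  apply: eq_integral => t _; congr f; apply: eq_from_tnth => i.
  rewrite tnth_mktuple; case: (unliftP ord0 i) => [j ->|->].
    by rewrite !tnth_tconsS tnth_mktuple.
  by rewrite !tnth_tcons0.
have mfu : measurable_fun [set: k.+1.-tuple R] (fun z : k.+1.-tuple R =>
    f z * (shift_density u' [tuple of behead z])%:E)%E.
  apply: emeasurable_funM => //; apply/measurable_EFinP.
  apply: measurableT_comp; first exact: measurable_shift_density.
  apply/measurable_fun_tnthP => i.
  rewrite (_ : _ \o _ = (fun z => tnth z (lift ord0 i))).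
    exact: measurable_tnth.
  by apply/funext => z /=; rewrite tnth_behead; congr tnth; apply: val_inj;
    rewrite /= inordK// ltnS.
have fu0 (z : k.+1.-tuple R) :
    (0 <= f z * (shift_density u' [tuple of behead z])%:E)%E.
  by rewrite mule_ge0// lee_fin expR_ge0.
have beheadE x (t : k.-tuple R) : [tuple of behead (tcons (x, t))] = t.
  exact: val_inj.
transitivity (\int[std_normal R]_x
  ((\int[power_prob (std_normal R) k]_t
      (f (tcons (x, t)) * (shift_density u' t)%:E)) *
   (expR (u ord0 * x - u ord0 ^+ 2 / 2))%:E))%E.
  pose F x := (\int[power_prob (std_normal R) k]_t
      (f (tcons (x, t)) * (shift_density u' t)%:E))%E.
  rewrite -(@ge0_integral_std_normal_shift F)//.
    have := measurable_section_power_prob (std_normal R) mfu fu0.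
    congr measurable_fun; apply/funext => x; apply: eq_integral => t _.
    by rewrite beheadE.
  by move=> x; apply: integral_ge0 => t _; rewrite mule_ge0// lee_fin expR_ge0.
apply: eq_integral => x _; rewrite -ge0_integralZr//; last 2 first.
- apply: emeasurable_funM; first exact: mfx.
  by apply/measurable_EFinP; exact: measurable_shift_density.
- by move=> t _; rewrite mule_ge0// lee_fin expR_ge0.
apply: eq_integral => t _; rewrite -muleA; congr (_ * _)%E.
rewrite -EFinM; congr EFin; rewrite /shift_density -expRD; congr expR.
rewrite /vdot /vdotf !big_ord_recl tnth_tcons0.
under [in RHS]eq_bigr do rewrite tnth_tconsS.
rewrite /u'; set a := \sum_(i < k) _; set b := \sum_(i < k) _.
by rewrite /=; field.
Qed.

End gaussian_shift.

Section gaussian_mixture.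
Context (R : realType) (k : nat) (I : finType) (u : I -> 'I_k -> R).
Local Notation gam := (power_prob (std_normal R) k).

Definition mixture_density (z : k.-tuple R) : R :=
  (\sum_(i : I) shift_density (u i) z) / #|I|%:R.

Lemma measurable_mixture_density :
  measurable_fun [set: k.-tuple R] mixture_density.
Proof.
apply: measurable_funM => //; apply: measurable_sum => i.
exact: measurable_shift_density.
Qed.

Lemma mixture_density_ge0 z : 0 <= mixture_density z.
Proof. by rewrite divr_ge0// sumr_ge0// => i _; exact: expR_ge0. Qed.

Lemma integral_shift_density (D : set (k.-tuple R)) (v : 'I_k -> R) :
  measurable D ->
  (\int[gam]_(z in D) (shift_density v z)%:E = gam (tshift v @^-1` D))%E.
Proof.
move=> mD.
have msD : measurable (tshift v @^-1` D).
  by rewrite -[X in measurable X]setTI; exact: measurable_tshift.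
transitivity (\int[gam]_z (\1_D (tshift v z))%:E)%E; last first.
  by rewrite -[in RHS](setIT (_ @^-1` _)) -integral_indic.
rewrite (@ge0_integral_power_normal_shift _ _ v (fun z => (\1_D z)%:E)).
- rewrite [LHS]integral_mkcond; apply: eq_integral => z _.
  by rewrite patchE indicE; case: (z \in D); rewrite ?mul1e ?mul0e.
- exact/measurable_EFinP/measurable_indic.
- by move=> z; rewrite lee_fin.
Qed.

Lemma integral_mixture_density (D : set (k.-tuple R)) : measurable D ->
  (\int[gam]_(z in D) (mixture_density z)%:E =
   (\sum_(i : I) gam (tshift (u i) @^-1` D)) * (#|I|%:R^-1)%:E)%E.
Proof.
move=> mD; rewrite /mixture_density.
under eq_integral => z _ do rewrite EFinM.
rewrite ge0_integralZr//; last 2 first.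
- apply/measurable_EFinP/measurable_funTS; apply: measurable_sum => i.
  exact: measurable_shift_density.
- by move=> z _; rewrite lee_fin sumr_ge0// => i _; exact: expR_ge0.
under eq_integral => z _ do rewrite -sumEFin.
rewrite ge0_integral_sum//; last 2 first.
- move=> i; apply/measurable_EFinP/measurable_funTS.
  exact: measurable_shift_density.
- by move=> i z _; rewrite lee_fin expR_ge0.
by congr (_ * _)%E; apply: eq_bigr => i _; exact: integral_shift_density.
Qed.

(** The product of the densities of two translates is the density of the
    translate by the sum, times the exponential of their inner product. *)
Lemma integral_sqr_mixture_density :
  (\int[gam]_z (mixture_density z ^+ 2)%:E =
   ((\sum_(i : I) \sum_(j : I) expR (vdotf (u i) (u j))) / #|I|%:R ^+ 2)%:E)%E.
Proof.
have E z : mixture_density z ^+ 2 = (\sum_(p : I * I)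
    expR (vdotf (u p.1) (u p.2)) *
      shift_density (fun l => u p.1 l + u p.2 l) z) * (#|I|%:R ^+ 2)^-1.
  rewrite /mixture_density exprMn exprVn; congr (_ * _).
  rewrite expr2 big_distrlr/= pair_bigA/=; apply: eq_bigr => -[i j] _ /=.
  rewrite /shift_density -!expRD; congr expR.
  set w := fun l => _.
  have -> : vdot w z = vdot (u i) z + vdot (u j) z.
    by rewrite /vdot -big_split/=; apply: eq_bigr => l _; rewrite mulrDl.
  have -> : vdotf w w =
      vdotf (u i) (u i) + vdotf (u j) (u j) + 2 * vdotf (u i) (u j).
    by rewrite /vdotf mulr_sumr -!big_split/=; apply: eq_bigr => l _;
      rewrite /w; ring.
  by field.
under eq_integral => z _ do rewrite E EFinM.
rewrite ge0_integralZr//; last 2 first.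
- apply/measurable_EFinP/measurable_sum => p; apply: measurable_funM => //.
  exact: measurable_shift_density.
- by move=> z _; rewrite lee_fin sumr_ge0// => p _; rewrite mulr_ge0// expR_ge0.
under eq_integral => z _ do rewrite -sumEFin.
rewrite ge0_integral_sum//; last 2 first.
- move=> p; apply/measurable_EFinP; apply: measurable_funM => //.
  exact: measurable_shift_density.
- by move=> p z _; rewrite lee_fin mulr_ge0 ?expR_ge0.
rewrite EFinM; congr (_ * _)%E.
rewrite pair_bigA -sumEFin/=; apply: eq_bigr => p _.
under eq_integral => z _ do rewrite EFinM.
rewrite ge0_integralZl//; last 2 first.
- by apply/measurable_EFinP; exact: measurable_shift_density.
- by move=> z _; rewrite lee_fin expR_ge0.
by rewrite integral_shift_density// preimage_setT probability_setT mule1.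
Qed.

(** Ingster's second moment method.  With [L] the density of the mixture, the
    double sum controls the integral of [(1 - L) ^+ 2] by [eta ^+ 2], and the
    pointwise bound [1 - L <= eta / 2 + (1 - L) ^+ 2 / (2 * eta)], integrated
    over [D], plays the role of the Cauchy-Schwarz inequality. *)
Lemma gaussian_mixture_test (eta : R) (D : set (k.-tuple R)) :
  0 < eta -> (0 < #|I|)%N -> measurable D ->
  \sum_(i : I) \sum_(j : I) expR (vdotf (u i) (u j)) <=
    (1 + eta ^+ 2) * #|I|%:R ^+ 2 ->
  (gam D <= eta%:E +
    (\sum_(i : I) gam (tshift (u i) @^-1` D)) * (#|I|%:R^-1)%:E)%E.
Proof.
move=> eta0 I0 mD chi.
have I0R : (0 : R) < #|I|%:R by rewrite ltr0n.
set L := mixture_density.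
have mL : measurable_fun [set: k.-tuple R] L := measurable_mixture_density.
have L0 := mixture_density_ge0.
have intL : (\int[gam]_z (L z)%:E = 1)%E.
  rewrite integral_mixture_density//.
  under eq_bigr do rewrite preimage_setT probability_setT.
  by rewrite sumEFin -EFinM sumr_const mulfV// lt0r_neq0.
pose V z := ((1 - L z) ^+ 2)%:E.
have mV : measurable_fun [set: k.-tuple R] V.
  by apply/measurable_EFinP; apply: measurable_funX; apply: measurable_funB.
have V0 z : (0 <= V z)%E by rewrite lee_fin sqr_ge0.
have intV : (\int[gam]_z V z <= (eta ^+ 2)%:E)%E.
  rewrite -(@leeD2rE _ 2%:E)//.
  have -> : 2%:E = (\int[gam]_z (2 * L z)%:E)%E :> \bar R.
    under eq_integral => z _ do rewrite EFinM.
    rewrite ge0_integralZl// ?intL ?mule1// ?lee_fin//.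
      exact/measurable_EFinP.
    by move=> z _; rewrite lee_fin.
  have m2L : measurable_fun [set: k.-tuple R] (fun z => (2 * L z)%:E).
    by apply/measurable_EFinP; apply: measurable_funM.
  have -> : (\int[gam]_z V z + \int[gam]_z (2 * L z)%:E =
      \int[gam]_z (1 + (L z ^+ 2)%:E))%E.
    rewrite -ge0_integralD//; last by move=> z _; rewrite lee_fin mulr_ge0.
    by apply: eq_integral => z _; rewrite /V -!EFinD; congr EFin; ring.
  rewrite ge0_integralD//; last 2 first.
    by move=> z _; rewrite lee_fin sqr_ge0.
    by apply/measurable_EFinP; apply: measurable_funX.
  have -> : (\int[gam]__ 1 = 1)%E.
    rewrite (integral_cst _ measurableT).
    by rewrite mul1e; exact: probability_setT.
  rewrite integral_sqr_mixture_density.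
  under eq_integral => z _ do rewrite EFinM.
  rewrite ge0_integralZl//; last 2 first.
  - exact/measurable_EFinP.
  - by move=> z _; rewrite lee_fin.
  rewrite intL mule1 -!EFinD lee_fin.
  have : (\sum_(i : I) \sum_(j : I) expR (vdotf (u i) (u j))) / #|I|%:R ^+ 2
    <= 1 + eta ^+ 2 by rewrite ler_pdivrMr// exprn_gt0.
  lra.
rewrite -integral_mixture_density//.
have -> : gam D = (\int[gam]_(z in D) 1)%E by rewrite integral_cst// mul1e.
apply: (@le_trans _ _ (\int[gam]_(z in D)
    ((eta / 2)%:E + (L z)%:E + (2 * eta)^-1%:E * V z))%E).
  apply: ge0_le_integral => //.
  - apply: measurable_funTS; apply: emeasurable_funD.
      by apply: emeasurable_funD => //; exact/measurable_EFinP.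
    by apply: emeasurable_funM.
  - move=> z _; rewrite /V -EFinM -!EFinD lee_fin.
    rewrite -(@ler_pM2l _ (2 * eta)) ?mulr_gt0//.
    rewrite 2!mulrDr mulrA mulfV ?mulf_neq0 ?lt0r_neq0//.
    have := sqr_ge0 (eta - (1 - L z)); set l := L z.
    rewrite (_ : 2 * eta * (eta / 2) = eta ^+ 2); last by field.
    by lra.
rewrite ge0_integralD//; last 4 first.
- by move=> z _; rewrite adde_ge0 ?lee_fin ?L0// divr_ge0// ltW.
- apply: measurable_funTS; apply: emeasurable_funD => //.
  exact/measurable_EFinP.
- by move=> z _; rewrite mule_ge0 ?V0// lee_fin invr_ge0 mulr_ge0// ltW.
- by apply: measurable_funTS; exact: emeasurable_funM.
rewrite ge0_integralD//; last 3 first.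
- by move=> z _; rewrite lee_fin divr_ge0// ltW.
- by move=> z _; rewrite lee_fin.
- exact/measurable_EFinP/measurable_funTS.
rewrite addeAC; apply: leeD => //.
rewrite [eta in leRHS](_ : _ = eta / 2 + (2 * eta)^-1 * eta ^+ 2); last first.
  by field; rewrite lt0r_neq0.
rewrite EFinD; apply: leeD.
  rewrite integral_cst// -[leRHS]mule1; apply: lee_wpmul2l.
    by rewrite lee_fin divr_ge0// ltW.
  exact: probability_le1.
rewrite ge0_integralZl//; last 2 first.
- exact: measurable_funTS.
- by rewrite lee_fin invr_ge0 mulr_ge0// ltW.
rewrite EFinM; apply: lee_wpmul2l.
  by rewrite lee_fin invr_ge0 mulr_ge0// ltW.
apply: le_trans intV; apply: ge0_subset_integral => //.
Qed.

End gaussian_mixture.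

(** * Entrywise exponentials of Gram matrices *)

Section schur.
Context (R : realType) (I : finType).
Implicit Types M D : I -> I -> R.

Definition psd M := forall c : I -> R,
  0 <= \sum_(i : I) \sum_(j : I) c i * c j * M i j.

(** The conclusion of Schur's product theorem, taken as a property of [D].  It
    is immediate for Gram matrices, in finite dimension or in L^2, by expanding
    the inner product, and it spares a factorisation of [M]. *)
Definition schur_multiplier D :=
  forall M, psd M -> psd (fun i j => D i j * M i j).

Lemma psd1 : psd (fun _ _ => 1).
Proof.
move=> c; under eq_bigr do under eq_bigr do rewrite mulr1.
by rewrite -big_distrlr/= -expr2 sqr_ge0.
Qed.

Lemma psdD M M' : psd M -> psd M' -> psd (fun i j => M i j + M' i j).
Proof.
move=> hM hM' c; under eq_bigr do under eq_bigr do rewrite mulrDr.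
by under eq_bigr do rewrite big_split/=; rewrite big_split/= addr_ge0.
Qed.

Lemma psdZ (a : R) M : 0 <= a -> psd M -> psd (fun i j => a * M i j).
Proof.
move=> a0 hM c; under eq_bigr do under eq_bigr do rewrite mulrCA.
by under eq_bigr do rewrite -mulr_sumr; rewrite -mulr_sumr mulr_ge0.
Qed.

Lemma psd_sum (N : nat) (M : nat -> I -> I -> R) :
  (forall r, psd (M r)) -> psd (fun i j => \sum_(0 <= r < N) M r i j).
Proof.
move=> hM; elim: N => [|N IH] c.
  by under eq_bigr do under eq_bigr do rewrite big_geq// mulr0;
    rewrite big1 // => i _; rewrite big1.
under eq_bigr do under eq_bigr do rewrite big_nat_recr//=.
exact: psdD IH (hM N) c.
Qed.

Lemma psd_lim (M : nat -> I -> I -> R) M' :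
  (forall N, psd (M N)) -> (forall i j, M N i j @[N --> \oo] --> M' i j) ->
  psd M'.
Proof.
move=> hM cM c.
have cvg : (\sum_(i : I) \sum_(j : I) c i * c j * M N i j) @[N --> \oo] -->
    \sum_(i : I) \sum_(j : I) c i * c j * M' i j.
  apply: cvg_big => [|i _]; first exact: add_continuous.
  apply: cvg_big => [|j _]; first exact: add_continuous.
  by apply: cvgMr => //; exact: cM.
rewrite -(cvg_lim _ cvg)//; apply: limr_ge.
  by apply/cvg_ex; eexists; exact: cvg.
by apply: nearW => N; exact: hM.
Qed.

Lemma schur_multiplierX D M (r : nat) : schur_multiplier D -> psd M ->
  psd (fun i j => D i j ^+ r * M i j).
Proof.
move=> hD hM; elim: r => [|r IH] c.
  by under eq_bigr do under eq_bigr do rewrite expr0 mul1r; exact: hM.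
under eq_bigr do under eq_bigr do rewrite exprS -(mulrA (D _ _)).
exact: hD IH c.
Qed.

(** All the terms of the exponential series but the first. *)
Lemma schur_multiplier_expR_subr1 D M : schur_multiplier D -> psd M ->
  psd (fun i j => (expR (D i j) - 1) * M i j).
Proof.
move=> hD hM.
pose T r i j : R := (r.+1`!%:R)^-1 * (D i j ^+ r.+1 * M i j).
apply: (@psd_lim (fun N i j => \sum_(0 <= r < N) T r i j)) => [N|i j].
  by apply: psd_sum => r; apply: psdZ => //; exact: schur_multiplierX.
have -> : (fun N => \sum_(0 <= r < N) T r i j) =
    (fun N => (series (exp_coeff (D i j)) N.+1 - 1) * M i j).
  apply/funext => N; rewrite /series/= big_nat_recl//= /exp_coeff/=.
  rewrite expr0 fact0 divr1 addrAC subrr add0r mulr_suml.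
  by apply: eq_bigr => r _; rewrite /T mulrA [_^-1 * _]mulrC.
apply: cvgMl; apply: cvgB; last exact: cvg_cst.
by rewrite (cvg_shiftS (series _)); exact: is_cvg_series_exp_coeff.
Qed.

Lemma schur_multiplier_expR D M : schur_multiplier D -> psd M ->
  psd (fun i j => expR (D i j) * M i j).
Proof.
move=> hD hM c.
apply: le_trans (psdD (schur_multiplier_expR_subr1 hD hM) hM c) _.
by apply: ler_sum => i _; apply: ler_sum => j _; rewrite mulrBl mul1r subrK.
Qed.

(** The difference of the two sides is the value at the constant vector of the
    quadratic form of [(expR D - 1) * expR G]. *)
Lemma sum_expR_leD G D : schur_multiplier G -> schur_multiplier D ->
  \sum_(i : I) \sum_(j : I) expR (G i j) <=
  \sum_(i : I) \sum_(j : I) expR (G i j + D i j).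
Proof.
move=> hG hD.
rewrite -subr_ge0 -sumrB.
apply: le_trans (schur_multiplier_expR_subr1 hD
  (schur_multiplier_expR hG psd1) (fun _ => 1)) _.
apply: ler_sum => i _; rewrite -sumrB; apply: ler_sum => j _.
by rewrite expRD; lra.
Qed.

Lemma schur_multiplier_vdotf k (h : I -> 'I_k -> R) :
  schur_multiplier (fun i j => \sum_(l < k) h i l * h j l).
Proof.
move=> M hM c.
rewrite (_ : (\sum_i _) = \sum_(l < k) \sum_i \sum_j
  (c i * h i l) * (c j * h j l) * M i j).
  by apply: sumr_ge0 => l _; exact: hM (fun i => c i * h i l).
rewrite [RHS]exchange_big/=; apply: eq_bigr => i _.
rewrite [RHS]exchange_big/=; apply: eq_bigr => j _.
rewrite mulr_suml mulr_sumr; apply: eq_bigr => l _; ring.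
Qed.

Lemma schur_multiplier_Rintegral d (T : measurableType d)
    (mu : {measure set T -> \bar R}) (r : I -> T -> R) :
  (forall i j, mu.-integrable setT (fun x => (r i x * r j x)%:E)) ->
  schur_multiplier (fun i j => \int[mu]_x (r i x * r j x)).
Proof.
move=> ir M hM c.
have E : \sum_i \sum_j c i * c j * ((\int[mu]_x (r i x * r j x)) * M i j) =
    \int[mu]_x \sum_i \sum_j c i * c j * M i j * (r i x * r j x).
  rewrite /Rintegral.
  under [X in _ = fine X]eq_integral => x _ do rewrite pair_bigA -sumEFin.
  rewrite integral_sum//; last first.
    by move=> p; under eq_fun do rewrite EFinM; exact: integrableZl.
  rewrite pair_bigA/= -sum_fine.
    apply: eq_bigr => -[i j] _ /=.
    under [in RHS]eq_integral => x _ do rewrite EFinM.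
    rewrite integralZl// fineM//; last exact: integrable_fin_num.
    by rewrite /=; ring.
  move=> p _; apply: integrable_fin_num => //.
  by under eq_fun do rewrite EFinM; exact: integrableZl.
rewrite E; apply: Rintegral_ge0 => x _.
apply: le_trans (hM (fun i => c i * r i x)) _.
apply: ler_sum => i _; apply: ler_sum => j _.
rewrite (_ : c i * r i x * (c j * r j x) * M i j =
  c i * c j * M i j * (r i x * r j x)) //; ring.
Qed.

End schur.

(** * Product measures and square-integrable functions *)

Section power_prob_prod.
Context d (T : measurableType d) (R : realType) (P : probability T R).

Lemma prod_tcons n (g : 'I_n.+1 -> T -> R) x (t : n.-tuple T) :
  \prod_(j < n.+1) g j (tnth (tcons (x, t)) j) =
  g ord0 x * \prod_(j < n) g (lift ord0 j) (tnth t j).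
Proof.
rewrite big_ord_recl; congr (_ * _); apply: eq_bigr => j _.
by congr g; rewrite !(tnth_nth x).
Qed.

Lemma measurable_prod_tnth n (g : 'I_n -> T -> R) :
  (forall j, measurable_fun setT (g j)) ->
  measurable_fun [set: n.-tuple T] (fun z => \prod_(j < n) g j (tnth z j)).
Proof.
move=> mg; apply: measurable_prod => j _.
by apply: (measurableT_comp (mg j)); exact: measurable_tnth.
Qed.

(** Integrability and the value of the integral go through the induction
    together, as Fubini's theorem needs the former. *)
Lemma integral_power_prob_prod n (g : 'I_n -> T -> R) :
  (forall j, P.-integrable setT (EFin \o g j)) ->
  (power_prob P n).-integrable setT
    (fun z => (\prod_(j < n) g j (tnth z j))%:E) /\
  \int[power_prob P n]_z (\prod_(j < n) g j (tnth z j)) =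
  \prod_(j < n) \int[P]_x g j x.
Proof.
elim: n g => [|n IH] g ig.
  under eq_fun do rewrite big_ord0.
  split; first exact: finite_measure_integrable_cst.
  rewrite /Rintegral; under eq_integral do rewrite big_ord0.
  rewrite integral_cst// mul1e big_ord0.
  exact: (congr1 fine (probability_setT (power_prob P 0))).
have [iF EF] := IH (fun j => g (lift ord0 j)) (fun j => ig (lift ord0 j)).
set F := fun t : n.-tuple T =>
  \prod_(j < n) g (lift ord0 j) (tnth t j) in iF EF.
have mg j : measurable_fun setT (g j) 
  by apply/measurable_EFinP; exact: measurable_int (ig j).
have mF : measurable_fun setT F 
  by apply/measurable_EFinP; exact: measurable_int iF.
pose h (z : T * n.-tuple T) := (g ord0 z.1 * F z.2)%:E.
have mh : measurable_fun setT h.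
  apply/measurable_EFinP; apply: measurable_funM.
    exact: (measurableT_comp (mg ord0) measurable_fst).
  exact: (measurableT_comp mF measurable_snd).
have ih : (P \x power_prob P n)%E.-integrable setT h.
  apply/integrable12ltyP => //.
  have E x : (\int[power_prob P n]_y `|h (x, y)| =
      `|(g ord0 x)%:E| * \int[power_prob P n]_y `|(F y)%:E|)%E.
    under eq_integral => y _ do rewrite /h/= normrM EFinM.
    rewrite ge0_integralZl//.
    by apply/measurable_EFinP; exact: measurableT_comp.
  under eq_integral => x _ do rewrite E.
  have [_ i0] := integrableP _ _ _ (ig ord0).
  have [_ i1] := integrableP _ _ _ iF.
  rewrite ge0_integralZr//.
  - by rewrite lte_mul_pinfty// ?integral_ge0// ge0_fin_numE// integral_ge0.
  - by apply/measurable_EFinP; exact: measurableT_comp.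
  - exact: integral_ge0.
have hE : (fun z : n.+1.-tuple T => (\prod_(j < n.+1) g j (tnth z j))%:E) \o
    @tcons _ T n = h.
  by apply/funext => -[x t] /=; rewrite prod_tcons.
have mG : measurable_fun [set: n.+1.-tuple T]
    (fun z => (\prod_(j < n.+1) g j (tnth z j))%:E).
  by apply/measurable_EFinP; exact: measurable_prod_tnth.
split.
  apply: (@integrable_pushforward _ _ _ _ _ _ (@measurable_tcons _ T n)) => //.
  by rewrite preimage_setT hE.
rewrite /Rintegral integral_distribution//; last by rewrite hE.
rewrite hE -integral12_prod_meas1//.
rewrite (eq_integral (fun x => (g ord0 x)%:E *
    (fine (\int[power_prob P n]_t (F t)%:E))%:E)%E); last first.
  move=> x _; rewrite /fubini_F /h/=; under eq_integral do rewrite EFinM.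
  by rewrite integralZl// fineK//; exact: integrable_fin_num.
rewrite (integralZr measurableT (ig ord0)) fineM//; last first.
  exact: integrable_fin_num (ig ord0).
rewrite big_ord_recl /=; congr (_ * _).
exact: EF.
Qed.

End power_prob_prod.

Section square_integrable.
Context d (T : measurableType d) (R : realType)
  (mu : {measure set T -> \bar R}).
Implicit Types f g : T -> R.

Definition sq_integrable f := measurable_fun setT f /\
  mu.-integrable setT (fun x => (f x ^+ 2)%:E).

Definition dot2 f g : R := \int[mu]_x (f x * g x).

Lemma sq_integrableM f g : sq_integrable f -> sq_integrable g ->
  mu.-integrable setT (fun x => (f x * g x)%:E).
Proof.
move=> [mf if2] [mg ig2].
apply: (@le_integrable _ _ _ mu _ measurableT _
  (fun x => (f x ^+ 2)%:E + (g x ^+ 2)%:E)%E).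
- by apply/measurable_EFinP; exact: measurable_funM.
- move=> x _; rewrite -EFinD !abse_EFin lee_fin [leRHS]ger0_norm; last first.
    by rewrite addr_ge0// sqr_ge0.
  rewrite normrM -(real_normK (num_real (f x))) -(real_normK (num_real (g x))).
  have := sqr_ge0 (`|f x| - `|g x|); have := normr_ge0 (f x).
  have := normr_ge0 (g x); nra.
- exact: integrableD.
Qed.

Lemma sq_integrable_lin (a : R) f g : sq_integrable f -> sq_integrable g ->
  sq_integrable (fun x => a * f x + g x).
Proof.
move=> hf hg; have ifg := sq_integrableM hf hg; case: hf hg => mf if2 [mg ig2].
split; first by apply: measurable_funD => //; exact: measurable_funM.
rewrite (_ : (fun x => _) = (fun x => (a ^+ 2)%:E * (f x ^+ 2)%:E +
    ((2 * a)%:E * (f x * g x)%:E + (g x ^+ 2)%:E))%E); last first.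
  by apply/funext => x; rewrite -!EFinM -!EFinD; congr EFin; ring.
apply: integrableD => //; first exact: integrableZl.
by apply: integrableD => //; exact: integrableZl.
Qed.

Lemma sq_integrable0 : sq_integrable (fun=> 0).
Proof.
split => //; under eq_fun do rewrite expr0n/=.
exact: integrable0.
Qed.

Lemma sq_integrableZ (a : R) f :
  sq_integrable f -> sq_integrable (fun x => a * f x).
Proof.
move=> hf; rewrite (_ : (fun x => _) = (fun x => a * f x + 0)).
  exact: sq_integrable_lin hf sq_integrable0.
by apply/funext => x; rewrite addr0.
Qed.

Lemma sq_integrable_sum (I : Type) (s : seq I) (Q : pred I) (F : I -> T -> R) :
  (forall i, Q i -> sq_integrable (F i)) ->
  sq_integrable (fun x => \sum_(i <- s | Q i) F i x).
Proof.
move=> hF; elim: s => [|i s IH].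
  by under eq_fun do rewrite big_nil; exact: sq_integrable0.
have [Qi|nQi] := boolP (Q i); last first.
  by under eq_fun do rewrite big_cons (negbTE nQi).
rewrite (_ : (fun x => _) =
    (fun x => 1 * F i x + \sum_(j <- s | Q j) F j x)).
  exact: sq_integrable_lin (hF i Qi) IH.
by apply/funext => x; rewrite big_cons Qi mul1r.
Qed.

Lemma dot2C f g : dot2 f g = dot2 g f.
Proof. by rewrite /dot2; under eq_Rintegral do rewrite mulrC. Qed.

Lemma dot2_linl (a : R) f g h : sq_integrable f -> sq_integrable g ->
  sq_integrable h ->
  dot2 (fun x => a * f x + g x) h = a * dot2 f h + dot2 g h.
Proof.
move=> hf hg hh; rewrite /dot2.
under eq_Rintegral do rewrite mulrDl -mulrA.
rewrite RintegralD//; last 2 first.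
- rewrite (_ : _ \o _ = (fun x => a%:E * (f x * h x)%:E)%E)//.
  by apply: integrableZl => //; exact: sq_integrableM.
- exact: sq_integrableM.
by rewrite RintegralZl//; exact: sq_integrableM.
Qed.

Lemma dot20l h : dot2 (fun=> 0) h = 0.
Proof.
rewrite /dot2; under eq_Rintegral do rewrite mul0r.
by rewrite /Rintegral integral0.
Qed.

Lemma dot2_suml (I : Type) (s : seq I) (Q : pred I) (a : I -> R)
    (F : I -> T -> R) h :
  (forall i, Q i -> sq_integrable (F i)) -> sq_integrable h ->
  dot2 (fun x => \sum_(i <- s | Q i) a i * F i x) h =
  \sum_(i <- s | Q i) a i * dot2 (F i) h.
Proof.
move=> hF hh; elim: s => [|i s IH].
  rewrite big_nil -[RHS](dot20l h); congr dot2.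
  by apply/funext => x; rewrite big_nil.
rewrite [in RHS]big_cons.
have [Qi|nQi] := boolP (Q i); last first.
  rewrite -IH; congr dot2; apply/funext => x.
  by rewrite big_cons (negbTE nQi).
rewrite -IH -dot2_linl//; last 2 first.
- exact: hF.
- by apply: sq_integrable_sum => j Qj; apply: sq_integrableZ; exact: hF.
by congr dot2; apply/funext => x; rewrite big_cons Qi.
Qed.

Lemma dot2_sumr (I : Type) (s : seq I) (Q : pred I) (a : I -> R)
    (F : I -> T -> R) h :
  (forall i, Q i -> sq_integrable (F i)) -> sq_integrable h ->
  dot2 h (fun x => \sum_(i <- s | Q i) a i * F i x) =
  \sum_(i <- s | Q i) a i * dot2 h (F i).
Proof.
move=> hF hh; rewrite dot2C dot2_suml//.
by apply: eq_bigr => i _; rewrite dot2C.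
Qed.

Lemma dot2_ge0 f : 0 <= dot2 f f.
Proof. by apply: Rintegral_ge0 => x _; rewrite -expr2 sqr_ge0. Qed.

(** The degenerate case of the Cauchy-Schwarz inequality: the squared norm of
    [a * f + g] is an affine function of [a], bounded below. *)
Lemma dot2_eq0 f g : sq_integrable f -> sq_integrable g ->
  dot2 f f = 0 -> dot2 f g = 0.
Proof.
move=> hf hg f0.
suff H (a : R) : 0 <= 2 * a * dot2 f g + dot2 g g.
  have g0 := dot2_ge0 g; set b := dot2 f g in H *; set q := dot2 g g in H g0.
  apply/eqP; case: (eqVneq b 0) => // b0.
  have := H (- (q + 1) / (2 * b)).
  rewrite (_ : 2 * (- (q + 1) / (2 * b)) * b = - (q + 1)); last by field.
  by lra.
have := dot2_ge0 (fun x => a * f x + g x).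
have hafg := sq_integrable_lin a hf hg.
by rewrite dot2_linl// (dot2C f) (dot2C g) !dot2_linl// f0 (dot2C g f); lra.
Qed.

End square_integrable.

(** * Finitely many linear measurements *)

Section projection.
Context d (T : measurableType d) (R : realType)
  (mu : {measure set T -> \bar R}).
Local Notation dot2 := (dot2 mu).
Local Notation sq_integrable := (sq_integrable mu).
Context (m : nat) (e : 'I_m -> T -> R).
Hypothesis he : forall l, sq_integrable (e l).

Definition gram : 'M[R]_m := \matrix_(i, j) dot2 (e i) (e j).

(** The normal equations of the projection onto the span of [e] are always
    consistent: a vector in the kernel of the Gram matrix gives a combination
    of the [e l] of norm zero, which is orthogonal to everything. *)
Lemma normal_equations (f : T -> R) : sq_integrable f ->
  exists c : 'I_m -> R, forall l, dot2 (e l) f = \sum_(j < m) c j * gram l j.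
Proof.
move=> hf; pose th : 'rV[R]_m := \row_l dot2 (e l) f.
have sub : (th <= gram)%MS.
  rewrite submxE; apply/eqP/matrixP => i j; rewrite mxE [RHS]mxE ord1.
  pose v l := cokermx gram l j.
  pose w x := \sum_(l < m) v l * e l x.
  have hw : sq_integrable w.
    by apply: sq_integrable_sum => l _; exact: sq_integrableZ.
  have gv l : \sum_(q < m) gram l q * v q = 0.
    have /matrixP/(_ l j) := mulmx_coker gram.
    by rewrite mxE [RHS]mxE.
  have w0 : dot2 w w = 0.
    rewrite dot2_suml// big1// => l _; rewrite dot2_sumr//.
    rewrite (eq_bigr (fun q => gram l q * v q)) ?gv ?mulr0// => q _.
    by rewrite mxE mulrC.
  have := dot2_eq0 hw hf w0; rewrite dot2_suml// => E0; rewrite -[RHS]E0.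
  by apply: eq_bigr => l _; rewrite mxE mulrC.
have [C thE] := submxP sub.
exists (fun j => C 0 j) => l.
have /matrixP/(_ 0 l) := thE; rewrite !mxE => ->.
by apply: eq_bigr => j _; rewrite !mxE dot2C.
Qed.

(** If [c] solves the normal equations for [f], then [h = A^T c] satisfies
    [A h = gram c], so that [A h] lists the measurements of [f], and the Gram
    matrix of the vectors [h] is that of the projections; [r] collects the
    residuals. *)
Lemma projection_coordinates k (A : 'M[R]_(m, k)) (I : Type) (f : I -> T -> R) :
  A *m A^T = gram -> (forall i, sq_integrable (f i)) ->
  exists (h : I -> 'I_k -> R) (r : I -> T -> R),
  [/\ forall i, sq_integrable (r i),
      forall i l, dot2 (e l) (f i) = \sum_(q < k) A l q * h i q &
      forall i j, dot2 (f i) (f j) = vdotf (h i) (h j) + dot2 (r i) (r j)].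
Proof.
move=> AA hf.
have [c cE] := choice (fun i => normal_equations (hf i)).
have gA l j : gram l j = \sum_(q < k) A l q * A j q.
  by rewrite -AA mxE; apply: eq_bigr => q _; rewrite mxE.
pose pf i x := \sum_(l < m) c i l * e l x.
have hpf i : sq_integrable (pf i).
  by apply: sq_integrable_sum => l _; exact: sq_integrableZ.
pose r i x := -1 * pf i x + f i x.
have hr i : sq_integrable (r i) by exact: sq_integrable_lin.
have er i l : dot2 (r i) (e l) = 0.
  rewrite dot2_linl// dot2_suml// (dot2C _ (f i)) cE mulN1r addrC.
  by apply/eqP; rewrite subr_eq0; apply/eqP/eq_bigr => j _; rewrite mxE dot2C.
have pr i j : dot2 (r i) (pf j) = 0.
  by rewrite dot2_sumr// big1// => l _; rewrite er mulr0.
exists (fun i q => \sum_(l < m) c i l * A l q), r; split => // [i l|i j].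
  rewrite cE; under eq_bigr do rewrite gA mulr_sumr.
  rewrite exchange_big/=; apply: eq_bigr => q _; rewrite mulr_sumr.
  by apply: eq_bigr => j _; ring.
have fE q : f q = (fun x => 1 * pf q x + r q x).
  by apply/funext => x; rewrite /r; ring.
have fr : dot2 (r i) (f j) = dot2 (r i) (r j).
  by rewrite dot2C [in LHS]fE dot2_linl// (dot2C _ (pf j)) pr mulr0 add0r dot2C.
rewrite [in LHS](fE i) dot2_linl// fr mul1r; congr (_ + _).
rewrite dot2_suml// /vdotf.
transitivity (\sum_(l < m) \sum_(l' < m) \sum_(q < k)
   (c i l * A l q) * (c j l' * A l' q)).
  apply: eq_bigr => l _; rewrite cE mulr_sumr; apply: eq_bigr => l' _.
  by rewrite gA !mulr_sumr; apply: eq_bigr => q _; ring.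
under eq_bigr do rewrite exchange_big/=.
rewrite exchange_big/=; apply: eq_bigr => q _.
by rewrite big_distrlr.
Qed.

End projection.

Section finite_dimensional_test.
Context d (T : measurableType d) (R : realType)
  (mu : {measure set T -> \bar R}).
Local Notation dot2 := (dot2 mu).
Local Notation sq_integrable := (sq_integrable mu).

Local Notation gam k := (power_prob (std_normal R) k).

Lemma measurable_mx_act m k (A : 'M[R]_(m, k)) :
  measurable_fun [set: k.-tuple R] (mx_act A).
Proof.
apply/measurable_fun_tnthP => i.
rewrite (_ : _ \o _ = (fun z => \sum_(j < k) A i j * tnth z j)).
  apply: measurable_sum => j; apply: measurable_funM => //.
  exact: measurable_tnth.
by apply/funext => z /=; rewrite tnth_mktuple.
Qed.

(** The observation at finitely many points, as a function of the noise [b]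
    there. *)
Definition affine_tuple m (th : 'I_m -> R) (a : R) (b : m.-tuple R) :=
  [tuple th i + a * tnth b i | i < m].

Lemma measurable_affine_tuple m (th : 'I_m -> R) (a : R) :
  measurable_fun [set: m.-tuple R] (affine_tuple th a).
Proof.
apply/measurable_fun_tnthP => i.
rewrite (_ : _ \o _ = (fun z => th i + a * tnth z i)).
  apply: measurable_funD => //; apply: measurable_funM => //.
  exact: measurable_tnth.
by apply/funext => z /=; rewrite tnth_mktuple.
Qed.

(** Data processing: finitely many linear measurements of a signal in white
    noise carry no more information than the signal itself, because removing
    the part of the signals orthogonal to the measurements lowers their Gram
    matrix.  The measurements are those of the projected signals, and a shift of
    the noise by [A (h i)] is the image under [A] of a shift of the standard
    Gaussian vector by [h i]. *)
Lemma measurements_test m k (e : 'I_m -> T -> R) (A : 'M[R]_(m, k))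
    (I : finType) (f : I -> T -> R) (n : nat) (eta : R) (D : set (m.-tuple R)) :
  (forall l, sq_integrable (e l)) -> (forall i, sq_integrable (f i)) ->
  A *m A^T = gram mu e -> (0 < n)%N -> 0 < eta -> (0 < #|I|)%N ->
  measurable D ->
  \sum_(i : I) \sum_(j : I) expR (n%:R * dot2 (f i) (f j)) <=
    (1 + eta ^+ 2) * #|I|%:R ^+ 2 ->
  (gam k (mx_act A @^-1`
      (affine_tuple (fun _ => 0%R) (Num.sqrt n%:R)^-1 @^-1` D)) <= eta%:E +
    (\sum_(i : I) gam k (mx_act A @^-1`
      (affine_tuple (fun l => dot2 (e l) (f i)) (Num.sqrt n%:R)^-1 @^-1` D)))
      * (#|I|%:R^-1)%:E)%E.
Proof.
move=> he hf AA n0 eta0 I0 mD chi; set a := (Num.sqrt n%:R)^-1.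
have [h [r [hr thE dotE]]] := projection_coordinates he AA hf.
have sn0 : 0 < Num.sqrt (n%:R : R) by rewrite sqrtr_gt0 ltr0n.
pose u i q : R := Num.sqrt n%:R * h i q.
set D' := mx_act A @^-1` (affine_tuple _ a @^-1` D).
have mD' : measurable D'.
  rewrite -[D']setTI; apply: measurable_mx_act => //.
  rewrite -[X in measurable X]setTI.
  by apply: measurable_affine_tuple.
have shiftE i : mx_act A @^-1`
    (affine_tuple (fun l => dot2 (e l) (f i)) a @^-1` D) =
    tshift (u i) @^-1` D'.
  have E z : affine_tuple (fun l => dot2 (e l) (f i)) a (mx_act A z) =
      affine_tuple (fun _ => 0) a (mx_act A (tshift (u i) z)).
    apply: eq_from_tnth => l; rewrite !tnth_mktuple add0r.
    under [in RHS]eq_bigr do rewrite tnth_mktuple mulrDr.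
    rewrite big_split/= mulrDr addrC; congr (_ + _).
    rewrite thE mulr_sumr; apply: eq_bigr => q _.
    by rewrite /u mulrCA (mulrA a) mulVf ?mul1r// gt_eqF.
  by apply/seteqP; split => z /=; rewrite E.
under eq_bigr do rewrite shiftE.
apply: gaussian_mixture_test => //.
apply: le_trans chi.
have uE i j : vdotf (u i) (u j) = n%:R * vdotf (h i) (h j).
  rewrite /vdotf mulr_sumr; apply: eq_bigr => q _.
  by rewrite /u mulrACA -expr2 sqr_sqrtr.
pose r' i x := Num.sqrt n%:R * r i x.
have rE i j : dot2 (r' i) (r' j) = n%:R * dot2 (r i) (r j).
  rewrite /dot2; under eq_Rintegral do rewrite mulrACA -expr2 sqr_sqrtr//.
  rewrite RintegralZl//; exact: sq_integrableM.
have hr' i : sq_integrable (r' i) by exact: sq_integrableZ.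
apply: le_trans (sum_expR_leD (schur_multiplier_vdotf u)
  (schur_multiplier_Rintegral (fun i j => sq_integrableM (hr' i) (hr' j)))) _.
apply: ler_sum => i _; apply: ler_sum => j _.
rewrite ler_expR dotE mulrDr -uE; apply: lerD => //.
by rewrite -rE.
Qed.

End finite_dimensional_test.

(** * Approximation of events by an algebra *)

Section approximation.
Context d (T : measurableType d) (R : realType) (I : finType)
  (mu : I -> probability T R) (G alg : set (set T)).
Hypothesis measurableG : @measurable _ T = <<s G >>.
Hypothesis subG : G `<=` alg.
Hypothesis alg_measurable : alg `<=` measurable.
Hypothesis algC : forall A, alg A -> alg (~` A).
Hypothesis algU : forall A B, alg A -> alg B -> alg (A `|` B).
Hypothesis alg0 : alg set0.

Definition approximable (A : set T) := measurable A /\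
  forall eps : R, 0 < eps -> exists2 C, alg C &
    forall i, (mu i ((A `\` C) `|` (C `\` A)) <= eps%:E)%E.

Lemma approximable_alg A : alg A -> approximable A.
Proof.
move=> hA; split; first exact: alg_measurable.
move=> eps eps0; exists A => // i.
by rewrite setDv setU0 measure0 lee_fin ltW.
Qed.

Lemma approximableC A : approximable A -> approximable (~` A).
Proof.
move=> [mA hA]; split; first exact: measurableC.
move=> eps /hA[C hC CE]; exists (~` C) => [|i]; first exact: algC.
rewrite (_ : _ `|` _ = (A `\` C) `|` (C `\` A))//.
by apply/seteqP; split => x /=; have := pselect (A x);
  have := pselect (C x); tauto.
Qed.

Lemma approximableU A B : approximable A -> approximable B ->
  approximable (A `|` B).
Proof.
move=> [mA hA] [mB hB]; split; first exact: measurableU.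
move=> eps eps0; have e2 : 0 < eps / 2 by rewrite divr_gt0.
have [C hC CE] := hA _ e2; have [D hD DE] := hB _ e2.
have [mC mD] := (alg_measurable hC, alg_measurable hD).
exists (C `|` D) => [|i]; first exact: algU.
rewrite [eps]splitr EFinD; apply: le_trans (leeD (CE i) (DE i)).
apply: le_trans (measureU2 _ _ _); last 2 first.
- by apply: measurableU; apply: measurableD.
- by apply: measurableU; apply: measurableD.
apply: le_measure; rewrite ?inE.
- by apply: measurableU; apply: measurableD; exact: measurableU.
- by do 2 apply: measurableU; apply: measurableD.
by move=> x /=; tauto.
Qed.

Lemma approximable_bigcup (F : (set T)^nat) :
  (forall k, approximable (F k)) -> approximable (\bigcup_k F k).
Proof.
move=> hF; have mF k : measurable (F k) by case: (hF k).
have mU : measurable (\bigcup_k F k) by exact: bigcupT_measurable.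
split => // eps eps0; have e2 : 0 < eps / 2 by rewrite divr_gt0.
pose U n := \big[setU/set0]_(k < n) F k.
have hU n : approximable (U n).
  rewrite /U; elim: n => [|n IH].
    by rewrite big_ord0; exact: approximable_alg.
  by rewrite big_ord_recr; exact: approximableU.
have mUn n : measurable (U n) by case: (hU n).
pose V n := (\bigcup_k F k) `\` U n.
have mV n : measurable (V n) by exact: measurableD.
have V0 : \bigcap_n V n = set0.
  apply/seteqP; split => // x Vx; have [[k _ Fkx] _] := Vx 0%N Logic.I.
  have [_] := Vx k.+1 Logic.I; apply.
  by rewrite /U -bigcup_mkord; exists k => /=.
have [N NE] : exists N, forall i, (mu i (V N) < (eps / 2)%:E)%E.
  suff [N _ HN] : \forall n \near \oo, forall i, (mu i (V n) < (eps / 2)%:E)%E.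
    by exists N => i; exact: HN N (leqnn N) i.
  apply: filter_forall => i.
  have cV : mu i \o V @ \oo --> mu i (\bigcap_n V n).
    apply: nonincreasing_cvg_mu => //.
    - exact: le_lt_trans (probability_le1 _ (mV 0%N)) (ltry _).
    - by rewrite V0.
    move=> n m nm; apply/subsetPset => x [Fx nUx]; split => //.
    apply: contra_not nUx; rewrite /U -!bigcup_mkord => -[k /= kn Fkx].
    by exists k => //=; exact: leq_trans kn nm.
  rewrite V0 measure0 in cV.
  have := cV [set y | (y < (eps / 2)%:E)%E]; apply.
  by apply: open_nbhs_nbhs; split => //; exact: open_ereal_lt_ereal.
have [_ /(_ _ e2)[C hC CE]] := hU N; have mC := alg_measurable hC.
exists C => // i.
rewrite [eps]splitr EFinD; apply: le_trans (leeD (ltW (NE i)) (CE i)).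
have mS : measurable ((U N `\` C) `|` (C `\` U N)).
  by apply: measurableU; exact: measurableD.
apply: le_trans (measureU2 _ (mV N) mS).
apply: le_measure; rewrite ?inE.
- by apply: measurableU; exact: measurableD.
- exact: measurableU.
have UF : U N `<=` \bigcup_k F k.
  by rewrite /U -bigcup_mkord => x [k _ Fx]; exists k.
by move=> x [[Fx nCx]|[Cx nFx]]; rewrite /V;
  [case: (pselect (U N x)) => ?; [right; left|left]
  |right; right; split => // /UF].
Qed.

(** The approximable sets form a sigma-algebra: a countable union differs from
    a finite one by a set that is small for all the finitely many measures. *)
Lemma measurable_approximable A : measurable A -> approximable A.
Proof.
rewrite measurableG; apply: smallest_sub; last first.
  by move=> B /subG; exact: approximable_alg.
split.
- exact: approximable_alg.
- by move=> B hB; rewrite setTD; exact: approximableC.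
- exact: approximable_bigcup.
Qed.

(** The measures of a set and of its approximation differ by an arbitrarily
    small amount, simultaneously, and the inequality is closed. *)
Lemma test_from_algebra (i0 : I) (J : finType) (f : J -> I) (eta : R) :
  (0 < #|J|)%N ->
  (forall C, alg C -> (mu i0 C <=
    eta%:E + (\sum_(j : J) mu (f j) C) * (#|J|%:R^-1)%:E)%E) ->
  forall A, measurable A -> (mu i0 A <=
    eta%:E + (\sum_(j : J) mu (f j) A) * (#|J|%:R^-1)%:E)%E.
Proof.
move=> J0 hC A mA; have J0R : (0 : R) < #|J|%:R by rewrite ltr0n.
apply/lee_addgt0Pr => eps eps0; have e2 : 0 < eps / 2 by rewrite divr_gt0.
have [_ /(_ _ e2)[C algCC CE]] := measurable_approximable mA.
have mC := alg_measurable algCC.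
have mS : measurable ((A `\` C) `|` (C `\` A)).
  by apply: measurableU; exact: measurableD.
have le1 i : (mu i A <= mu i C + (eps / 2)%:E)%E.
  apply: le_trans (leeD2l _ (CE i)); apply: le_trans (measureU2 _ mC mS).
  apply: le_measure; rewrite ?inE//; first exact: measurableU.
  by move=> x Ax /=; have := pselect (C x); tauto.
have le2 i : (mu i C <= mu i A + (eps / 2)%:E)%E.
  apply: le_trans (leeD2l _ (CE i)); apply: le_trans (measureU2 _ mA mS).
  apply: le_measure; rewrite ?inE//; first exact: measurableU.
  by move=> x Ax /=; have := pselect (A x); tauto.
apply: le_trans (le1 i0) _.
rewrite [eps in leRHS]splitr EFinD addeA; apply: leeD => //.
apply: le_trans (hC C algCC) _; rewrite -addeA; apply: leeD => //.
apply: (@le_trans _ _ ((\sum_(j : J) (mu (f j) A + (eps / 2)%:E)) *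
    (#|J|%:R^-1)%:E)%E).
  by apply: lee_wpmul2r; [rewrite lee_fin|exact: lee_sum].
rewrite big_split/= ge0_muleDl; last 2 first.
- by apply: sume_ge0 => i _; exact: measure_ge0.
- by apply: sume_ge0 => i _; rewrite lee_fin ltW.
apply: leeD => //; rewrite sumEFin sumr_const -EFinM lee_fin.
by rewrite -[(eps / 2) *+ _]mulr_natr mulfK// gt_eqF.
Qed.

End approximation.

(** * Testing in the white noise model *)

Section boxes.
Context (R : realType) (p : nat).
Local Notation cube := (unit_cube_leb R p).

Definition below (c : R) (u : R) : R := (u <= c)%R%:R.

Lemma belowE c : below c = \1_(`]-oo, c]%classic).
Proof. by apply/funext => u; rewrite indicE /below mem_setE in_itv. Qed.

Lemma integrable_below c : (unit_leb R).-integrable setT (EFin \o below c).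
Proof. by rewrite belowE; exact: integrable_indic. Qed.

Lemma integral_below c : in_unit c -> \int[unit_leb R]_u below c u = c.
Proof.
move=> /andP[c0 c1]; rewrite /Rintegral belowE integral_indic//= setIT.
rewrite /uniform_prob integral_uniform_pdf.
rewrite (_ : _ `&` _ = `[0, c]%classic); last first.
  apply/seteqP; split => x /=; rewrite !in_itv/=.
    by move=> [xc /andP[-> _]].
  by move=> /andP[x0 xc]; rewrite xc x0 (le_trans xc).
rewrite (eq_integral (fun=> 1%E)); last first.
  move=> x; rewrite inE/= in_itv/= /uniform_pdf => /andP[x0 xc].
  by rewrite x0 (le_trans xc)//= subr0 invr1.
rewrite integral_cst//= mul1e lebesgue_measure_itv/= lte_fin.
by have [_|cle] := ltP 0 c => /=; lra.
Qed.

(** The indicator of [[0, x]], written as a product so that its integrals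
    factorise over the coordinates. *)
Definition box (x u : p.-tuple R) : R :=
  \prod_(l < p) below (tnth x l) (tnth u l).

Lemma boxE x u : box x u = (`[< forall j, tnth u j <= tnth x j >])%:R.
Proof.
rewrite /box /below; case: asboolP => [ux|/existsNP[j /negP uxj]].
  by rewrite big1// => j _; rewrite ux.
by rewrite (bigD1 j)//= (negbTE uxj) mul0r.
Qed.

Lemma boxM x y u : box x u * box y u =
  \prod_(l < p) below (Num.min (tnth x l) (tnth y l)) (tnth u l).
Proof.
rewrite /box -big_split/=; apply: eq_bigr => l _.
by rewrite /below -natrM mulnb le_min.
Qed.

Lemma sq_integrable_box x : sq_integrable cube (box x).
Proof.
split.
  apply: (measurable_prod_tnth (g := fun l => below (tnth x l))) => l.
  rewrite belowE.
  exact: measurable_indic.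
under eq_fun do rewrite expr2 boxM.
by have [] := @integral_power_prob_prod _ _ R (unit_leb R) p
  (fun l => below (Num.min (tnth x l) (tnth x l)))
  (fun l => integrable_below _).
Qed.

Lemma dot2_box x y : in_cube x -> in_cube y ->
  dot2 cube (box x) (box y) =
  \prod_(l < p) Num.min (tnth x l) (tnth y l).
Proof.
move=> /all_tnthP hx /all_tnthP hy; rewrite /dot2.
under eq_Rintegral do rewrite boxM.
have [_ ->] := @integral_power_prob_prod _ _ R (unit_leb R) p
  (fun l => below (Num.min (tnth x l) (tnth y l)))
  (fun l => integrable_below _).
apply: eq_bigr => l _; apply: integral_below.
by case: leP => _; [exact: hx|exact: hy].
Qed.

Lemma Rintegral_box (x : p.-tuple R) (f : p.-tuple R -> R) :
  \int[cube]_(u in [set u | forall j, tnth u j <= tnth x j]) f u =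
  dot2 cube (box x) f.
Proof.
rewrite Rintegral_mkcond; apply: eq_Rintegral => u _.
rewrite patchE boxE; case: asboolP => hu.
  by rewrite mem_set// mul1r.
by rewrite memNset// mul0r.
Qed.

End boxes.

Section cylinder_algebra.
Context (R : realType) (p : nat).
Local Notation path := (path_space R p).

Definition restriction m (x : 'I_m -> p.-tuple R) (y : path) : m.-tuple R :=
  [tuple y (x i) | i < m].

Definition finite_cylinder : set (set path) :=
  [set A | exists m (x : 'I_m -> p.-tuple R) (D : set (m.-tuple R)),
    [/\ forall i, in_cube (x i), measurable D & A = restriction x @^-1` D]].

Lemma measurable_restriction m (x : 'I_m -> p.-tuple R) :
  (forall i, in_cube (x i)) -> measurable_fun [set: path] (restriction x).
Proof.
move=> hx; apply/measurable_fun_tnthP => i _ D mD; rewrite setTI.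
apply: sub_sigma_algebra; exists (x i) => //; exists D => //.
by apply/seteqP; split => y /=; rewrite tnth_mktuple.
Qed.

Lemma finite_cylinder_measurable : finite_cylinder `<=` measurable.
Proof.
move=> _ [m [x [D [hx mD ->]]]]; rewrite -[X in measurable X]setTI.
exact: measurable_restriction.
Qed.

Lemma finite_cylinderC A : finite_cylinder A -> finite_cylinder (~` A).
Proof.
move=> [m [x [D [hx mD ->]]]]; exists m, x, (~` D); split => //.
exact: measurableC.
Qed.

Lemma finite_cylinder0 : finite_cylinder set0.
Proof.
exists 0%N, (fun _ => [tuple of nseq p 0]), set0; split => //.
by case.
Qed.

Lemma cylinders_finite : @cylinders R p `<=` finite_cylinder.
Proof.
move=> _ [x hx [D mD ->]].
exists 1%N, (fun _ => x), ((fun t => tnth t ord0) @^-1` D); split => //.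
- rewrite -[X in measurable X]setTI.
  exact: (@measurable_tnth _ _ 1 ord0).
- by apply/seteqP; split => y /=; rewrite tnth_mktuple.
Qed.

(** Two events that depend on finitely many points are expressed on the
    concatenation of the two lists of points. *)
Lemma finite_cylinderU A B :
  finite_cylinder A -> finite_cylinder B -> finite_cylinder (A `|` B).
Proof.
move=> [m [x [D [hx mD ->]]]] [m' [x' [D' [hx' mD' ->]]]].
pose xx (i : 'I_(m + m')) :=
  match fintype.split i with inl j => x j | inr j => x' j end.
pose L (t : (m + m').-tuple R) := [tuple tnth t (lshift m' i) | i < m].
pose L' (t : (m + m').-tuple R) := [tuple tnth t (rshift m i) | i < m'].
have mL : measurable_fun [set: (m + m').-tuple R] L.
  apply/measurable_fun_tnthP => i.
  rewrite (_ : _ \o _ = (fun t => tnth t (lshift m' i))).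
    exact: measurable_tnth.
  by apply/funext => t /=; rewrite tnth_mktuple.
have mL' : measurable_fun [set: (m + m').-tuple R] L'.
  apply/measurable_fun_tnthP => i.
  rewrite (_ : _ \o _ = (fun t => tnth t (rshift m i))).
    exact: measurable_tnth.
  by apply/funext => t /=; rewrite tnth_mktuple.
exists (m + m')%N, xx, (L @^-1` D `|` L' @^-1` D'); split.
- by move=> i; rewrite /xx; case: fintype.split.
- by apply: measurableU; rewrite -[X in measurable X]setTI;
    [apply: mL|apply: mL'].
have LE y : L (restriction xx y) = restriction x y.
  apply: eq_from_tnth => i; rewrite !tnth_mktuple /xx.
  by rewrite (unsplitK (inl i : 'I_m + 'I_m')).
have LE' y : L' (restriction xx y) = restriction x' y.
  apply: eq_from_tnth => i; rewrite !tnth_mktuple /xx.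
  by rewrite (unsplitK (inr i : 'I_m + 'I_m')).
by apply/seteqP; split => y /=; rewrite LE LE'.
Qed.

End cylinder_algebra.

Section white_noise_test.
Context (R : realType) (p n : nat) d (Omega : measurableType d)
  (P : probability Omega R) (B : p.-tuple R -> Omega -> R).
Hypothesis B_sheet : brownian_sheet P B.
Hypothesis n0 : (0 < n)%N.
Local Notation cube := (unit_cube_leb R p).
Local Notation a := ((Num.sqrt (n%:R : R))^-1).

Lemma restriction_observation m (x : 'I_m -> p.-tuple R) f w :
  restriction x (observation B n f w) =
  affine_tuple (fun l => dot2 cube (box (x l)) f) a [tuple B (x i) w | i < m].
Proof.
apply: eq_from_tnth => i; rewrite !tnth_mktuple /observation.
by rewrite Rintegral_box.
Qed.

Lemma measurable_observation f : measurable_fun setT (observation B n f).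
Proof.
refine (@measurability _ _ Omega (path_space R p) setT _
  (@cylinders R p) _ _) => //.
move=> _ [_ [x hx [D mD ->]] <-]; rewrite setTI.
have mB : measurable_fun setT (fun w => observation B n f w x).
  apply: measurable_funD => //; apply: measurable_funM => //.
  exact: B_sheet.1.
by rewrite -[X in measurable X]setTI; exact: mB.
Qed.

HB.instance Definition _ f :=
  isMeasurableFun.Build _ _ _ _ (observation B n f) (measurable_observation f).

(** On finite-dimensional cylinders the law of the observation is Gaussian and
    its mean consists of the inner products of the signal with indicators of
    boxes, whose Gram matrix is the covariance of the Brownian sheet. *)
Lemma white_noise_test (I : finType) (f : I -> p.-tuple R -> R) (eta : R) :
  (forall i, sq_integrable cube (f i)) -> 0 < eta -> (0 < #|I|)%N ->
  \sum_(i : I) \sum_(j : I) expR (n%:R * dot2 cube (f i) (f j)) <=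
    (1 + eta ^+ 2) * #|I|%:R ^+ 2 ->
  forall A : set (path_space R p), measurable A ->
  (law P B n (fun=> 0%R) A <= eta%:E +
    (\sum_(i : I) law P B n (f i) A) * (#|I|%:R^-1)%:E)%E.
Proof.
move=> hf eta0 I0 chi.
pose mu (o : option I) : probability (path_space R p) R :=
  distribution P (observation B n (if o is Some i then f i else (fun=> 0))).
apply: (@test_from_algebra _ _ _ _ mu (@cylinders R p) (@finite_cylinder R p)
  erefl (@cylinders_finite R p) (@finite_cylinder_measurable R p)
  (@finite_cylinderC R p) (@finite_cylinderU R p) (@finite_cylinder0 R p)
  None I Some) => // _ [m [x [D [hx mD ->]]]].
have [k [A [AA PE]]] := B_sheet.2 m x hx.
have lawE g : law P B n g (restriction x @^-1` D) =
    power_prob (std_normal R) k (mx_act A @^-1`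
      (affine_tuple (fun l => dot2 cube (box (x l)) g) a @^-1` D)).
  rewrite -PE; last first.
    by rewrite -[X in measurable X]setTI; exact: measurable_affine_tuple.
  rewrite /law /pushforward; congr (P _).
  by apply/seteqP; split => w /=; rewrite restriction_observation.
have g0 : (fun l => dot2 cube (box (x l)) (fun=> 0)) = (fun=> 0).
  by apply/funext => l; rewrite dot2C dot20l.
rewrite [leLHS](lawE (fun=> 0)) g0.
under eq_bigr do rewrite [mu _ _]lawE.
apply: measurements_test => //.
- by move=> l; exact: sq_integrable_box.
- rewrite AA; apply/matrixP => i j; rewrite !mxE.
  by rewrite dot2_box.
Qed.

(** The worst-case error over the alternatives is at least the average error
    over a finite family of them. *)
Lemma minimax_testing_risk_ge (I : finType) (f : I -> p.-tuple R -> R)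
    (eta : R) (alt : set (p.-tuple R -> R)) :
  (forall i, sq_integrable cube (f i)) -> 0 < eta -> (0 < #|I|)%N ->
  (forall i, alt (f i)) ->
  \sum_(i : I) \sum_(j : I) expR (n%:R * dot2 cube (f i) (f j)) <=
    (1 + eta ^+ 2) * #|I|%:R ^+ 2 ->
  ((1 - eta)%:E <= minimax_testing_risk P B n alt)%E.
Proof.
move=> hf eta0 I0 falt chi.
have I0R : (0 : R) < #|I|%:R by rewrite ltr0n.
apply: le_ereal_inf_tmp => _ [phi _ <-].
pose A := [set y | phi y != true].
have mA : measurable A.
  rewrite (_ : A = phi @^-1` [set false]).
    by rewrite -[X in measurable X]setTI; exact: measurable_funP.
  by apply/seteqP; split => y; rewrite /A /=; case: (phi y).
have -> : [set y | phi y != false] = ~` A.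
  by apply/seteqP; split => y; rewrite /A /=; case: (phi y).
set S := ereal_sup _.
have S_ge i : (law P B n (f i) A <= S)%E.
  by apply: ereal_sup_ubound; exists (f i).
have avgS : ((\sum_(i : I) law P B n (f i) A) * (#|I|%:R^-1)%:E <= S)%E.
  have [i0 _] : exists i0 : I, i0 \in I by move/card_gt0P : I0.
  have S0 : (0 <= S)%E by apply: le_trans (S_ge i0); exact: measure_ge0.
  apply: (@le_trans _ _ ((\sum_(i : I) S) * (#|I|%:R^-1)%:E)%E).
    by apply: lee_wpmul2r; [rewrite lee_fin|exact: lee_sum].
  case: (S) S0 => [s s0|_|]; [|by rewrite leey|by rewrite leNgt ltNy0].
  rewrite sumEFin -EFinM lee_fin sumr_const -[_ *+ _]mulr_natr mulfK//.
  by rewrite gt_eqF.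
have := white_noise_test hf eta0 I0 chi mA.
move=> /le_trans/(_ (leeD2l eta%:E avgS)).
pose mu : probability (path_space R p) R :=
  distribution P (observation B n (fun=> 0)).
have -> : law P B n (fun=> 0) (~` A) = (1 - mu A)%E.
  exact: (probability_setC mu mA).
have -> : law P B n (fun=> 0) A = mu A by [].
have : mu A \is a fin_num by exact: fin_num_measure.
case: (mu A) => //= q _; case: S {S_ge avgS} => [s| |]; rewrite ?leey//=.
by rewrite -!EFinB -!EFinD !lee_fin; lra.
Qed.

End white_noise_test.

(** * The unit ball of a reproducing kernel Hilbert space *)

Section rkhs_membership.
Context (R : realType) (H : set (R -> R))
  (dot : (R -> R) -> (R -> R) -> R) (K : R -> R -> R).
Hypothesis rk : is_rkhs H dot K.

Lemma rkhs_dot_linr (a : R) f g h : H f -> H g -> H h ->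
  dot h (fun x => a * f x + g x) = a * dot h f + dot h g.
Proof.
move=> hf hg hh; have hl := rkhs_lin rk a hf hg.
by rewrite (rkhs_dotC rk hh hl) (rkhs_dot_lin rk)// (rkhs_dotC rk hf hh)
  (rkhs_dotC rk hg hh).
Qed.

Lemma rkhs_dot0 h : H h -> dot (fun=> 0) h = 0.
Proof.
move=> hh; have h0 := rkhs_zero rk.
have := rkhs_dot_lin rk 1 h0 h0 hh.
rewrite (_ : (fun _ => _) = (fun=> 0)); first by lra.
by apply/funext => x; rewrite mulr0 addr0.
Qed.

Lemma rkhs_dot_ge0 h : H h -> 0 <= dot h h.
Proof.
move=> hh; have [->|/eqP h0] := pselect (h = (fun=> 0)).
  by rewrite rkhs_dot0//; exact: (rkhs_zero rk).
by apply/ltW/(rkhs_dot_gt0 rk) => //; exact/eqP.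
Qed.

Lemma dnorm_sqr h : H h -> dnorm dot h ^+ 2 = dot h h.
Proof. by move=> hh; rewrite /dnorm sqr_sqrtr// rkhs_dot_ge0. Qed.

(** The discriminant of a nonnegative quadratic polynomial. *)
Lemma quadratic_ge0 (A B C : R) : 0 <= A -> 0 <= C ->
  (forall t : R, 0 <= A * t ^+ 2 + 2 * t * B + C) -> B ^+ 2 <= A * C.
Proof.
rewrite le_eqVlt => /predU1P[<-|A0] C0 H0.
  rewrite mul0r; case: (eqVneq B 0) => [->|B0]; first by rewrite expr0n.
  have := H0 (- (C + 1) / (2 * B)).
  rewrite (_ : 2 * (- (C + 1) / (2 * B)) * B = - (C + 1)); last by field.
  by rewrite mul0r; lra.
have := H0 (- B / A).
rewrite (_ : A * (- B / A) ^+ 2 + 2 * (- B / A) * B + C = (A * C - B ^+ 2) / A).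
  by rewrite pmulr_lge0 ?invr_gt0// subr_ge0.
by field; rewrite gt_eqF.
Qed.

Lemma rkhs_dot_lin2 (t : R) f g : H f -> H g ->
  dot (fun x => t * g x + f x) (fun x => t * g x + f x) =
  dot g g * t ^+ 2 + 2 * t * dot f g + dot f f.
Proof.
move=> hf hg; have hfg := rkhs_lin rk t hg hf.
rewrite (rkhs_dot_lin rk)// !rkhs_dot_linr// (rkhs_dotC rk hg hf).
ring.
Qed.

Lemma rkhs_CauchySchwarz f g : H f -> H g ->
  dot f g ^+ 2 <= dot g g * dot f f.
Proof.
move=> hf hg; apply: quadratic_ge0 => [||t]; rewrite ?rkhs_dot_ge0//.
by rewrite -rkhs_dot_lin2// rkhs_dot_ge0//; exact: (rkhs_lin rk).
Qed.

(** A finite combination [\sum_i c_i K x_i] is encoded by the list of the pairs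
    [(c_i, x_i)]. *)
Definition kspan (s : seq (R * R)) (y : R) : R := \sum_(q <- s) q.1 * K q.2 y.

Definition kvalid (s : seq (R * R)) := all (fun q => in_unit q.2) s.

Definition kpair (g : R -> R) (s : seq (R * R)) : R :=
  \sum_(q <- s) q.1 * g q.2.

Definition kscale (a : R) (s : seq (R * R)) := [seq (a * q.1, q.2) | q <- s].

Lemma kvalid_lin a s t : kvalid s -> kvalid t -> kvalid (kscale a s ++ t).
Proof.
by move=> vs vt; rewrite /kvalid all_cat all_map; apply/andP.
Qed.

Lemma kspan_lin a s t :
  kspan (kscale a s ++ t) = (fun x => a * kspan s x + kspan t x).
Proof.
apply/funext => x; rewrite /kspan big_cat big_map/= mulr_sumr; congr (_ + _).
by apply: eq_bigr => q _; rewrite mulrA.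
Qed.

Lemma kpair_lin g a s t :
  kpair g (kscale a s ++ t) = a * kpair g s + kpair g t.
Proof.
rewrite /kpair big_cat big_map/= mulr_sumr; congr (_ + _).
by apply: eq_bigr => q _; rewrite mulrA.
Qed.

Lemma kspan_cons q s : kspan (q :: s) = (fun x => q.1 * K q.2 x + kspan s x).
Proof. by apply/funext => x; rewrite /kspan big_cons. Qed.

Lemma kspan_nil : kspan [::] = (fun=> 0).
Proof. by apply/funext => x; rewrite /kspan big_nil. Qed.

Lemma kpair_nil g : kpair g [::] = 0.
Proof. by rewrite /kpair big_nil. Qed.

Lemma rkhs_kspan s : kvalid s -> H (kspan s).
Proof.
elim: s => [_|q s IH /andP[hq hs]].
  by rewrite kspan_nil; exact: (rkhs_zero rk).
rewrite kspan_cons; apply: (rkhs_lin rk); last exact: IH.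
exact: (rkhs_kernel rk).
Qed.

Lemma dot_kspan s h : kvalid s -> H h -> dot (kspan s) h = kpair h s.
Proof.
move=> + hh; elim: s => [_|q s IH /andP[hq hs]].
  by rewrite kspan_nil rkhs_dot0// /kpair big_nil.
have hK : H (K q.2) by exact: (rkhs_kernel rk).
rewrite kspan_cons (rkhs_dot_lin rk)//; last exact: rkhs_kspan.
by rewrite IH// /kpair big_cons (rkhs_dotC rk hK hh) (rkhs_reproducing rk).
Qed.

Section riesz.
Variable g : R -> R.
Hypothesis g_supp : forall x, ~~ in_unit x -> g x = 0.
Hypothesis g_bound : forall s, kvalid s ->
  2 * kpair g s <= 1 + dot (kspan s) (kspan s).

Let J s := dot (kspan s) (kspan s) - 2 * kpair g s.

Let Jset : set R := [set J s | s in [set s | kvalid s]].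

Let Jinf : has_inf Jset.
Proof.
split; first by exists (J [::]); exists [::].
by exists (-1) => _ [s vs <-]; have := g_bound vs; rewrite /J; lra.
Qed.

Let Jmin : exists u : nat -> seq (R * R), forall n,
  kvalid (u n) /\ J (u n) < inf Jset + n.+1%:R^-1.
Proof.
have h n : exists s, kvalid s /\ J s < inf Jset + n.+1%:R^-1.
  have n0 : 0 < n.+1%:R^-1 :> R by rewrite invr_gt0 ltr0n.
  by have [_ [s vs <-] Js] := inf_adherent n0 Jinf; exists s.
by have [u hu] := choice h; exists u.
Qed.

Let Jge s : kvalid s -> inf Jset <= J s.
Proof. by move=> vs; apply: ge_inf; [exact: Jinf.2|exists s]. Qed.

Let J_lin t s s' : kvalid s -> kvalid s' ->
  J (kscale t s' ++ s) = dot (kspan s') (kspan s') * t ^+ 2 +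
    2 * t * (dot (kspan s) (kspan s') - kpair g s') + J s.
Proof.
move=> vs vs'; rewrite /J kspan_lin kpair_lin rkhs_dot_lin2; last 2 first.
- exact: rkhs_kspan.
- exact: rkhs_kspan.
ring.
Qed.

(** Riesz representation.  The functional sending [K x] to [g x] on the span of
    the kernel sections has norm at most one, which [g_bound] expresses in a
    form linear in it.  A minimising sequence of
    [J s = |u_s| ^+ 2 - 2 * kpair g s] is Cauchy by the parallelogram identity;
    by stationarity of [J] along [K x] it converges to [g] at every point [x],
    so that its limit in the space is [g], and [g_bound] passes to the limit. *)
Lemma rkhs_unit_ball : H g /\ dot g g <= 1.
Proof.
have [u hu] := Jmin; pose v n := kspan (u n).
have hv n : H (v n) by apply: rkhs_kspan; exact: (hu n).1.
have hsub f1 f2 : H f1 -> H f2 -> H (f1 \- f2).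
  move=> h1 h2; rewrite (_ : f1 \- f2 = (fun x => -1 * f2 x + f1 x)).
    exact: (rkhs_lin rk).
  by apply/funext => x /=; ring.
have dsub f1 f2 : H f1 -> H f2 ->
    dot (f1 \- f2) (f1 \- f2) = dot f1 f1 - 2 * dot f1 f2 + dot f2 f2.
  move=> h1 h2; rewrite (_ : f1 \- f2 = (fun x => -1 * f2 x + f1 x)).
    by rewrite rkhs_dot_lin2//; ring.
  by apply/funext => x /=; ring.
have cauchy i j : dot (v i \- v j) (v i \- v j) <=
    2 * (i.+1%:R^-1 + j.+1%:R^-1).
  have [vi Ji] := hu i; have [vj Jj] := hu j.
  (* The parallelogram identity at the midpoint [(u_i + u_j) / 2]. *)
  pose w := kscale (2^-1) (kscale 1 (u i) ++ u j) ++ [::].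
  have vw : kvalid w by do 2 apply: kvalid_lin => //.
  have := Jge vw; rewrite /w J_lin//; last exact: kvalid_lin.
  rewrite /J kspan_nil !rkhs_dot0; last 2 first.
  - exact: (rkhs_zero rk).
  - by apply: rkhs_kspan; exact: kvalid_lin.
  rewrite kspan_lin kpair_lin rkhs_dot_lin2; last 2 first.
  - exact: hv.
  - exact: hv.
  rewrite dsub// (rkhs_dotC rk (hv i) (hv j)).
  move: Ji Jj; rewrite /J -/(v i) -/(v j) kpair_nil.
  set A := dot (v i) _; set D := dot (v j) _; set C := dot (v j) (v i).
  set x := i.+1%:R^-1; set y := j.+1%:R^-1.
  by lra.
have [h hh hlim] : exists2 h, H h &
    (fun i => dnorm dot (v i \- h)) @ \oo --> (0 : R).
  apply: (rkhs_complete rk) => // e e0.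
  have e4 : 0 < e ^+ 2 / 4 by rewrite divr_gt0// exprn_gt0.
  have [N _ HN] := near_infty_natSinv_lt (PosNum e4).
  exists N => i j Ni Nj.
  rewrite -(@ltr_pXn2r _ 2)// ?nnegrE ?sqrtr_ge0 ?ltW//.
  rewrite dnorm_sqr; last exact: hsub.
  apply: le_lt_trans (cauchy i j) _.
  have /= := HN i Ni; have /= := HN j Nj.
  by set x := i.+1%:R^-1; set y := j.+1%:R^-1; set z := e ^+ 2; lra.
have small (e : R) : 0 < e -> exists n, n.+1%:R^-1 < e /\
    dot (v n \- h) (v n \- h) < e.
  move=> e0; have se0 : 0 < Num.sqrt e by rewrite sqrtr_gt0.
  have [N _ HN] := near_infty_natSinv_lt (PosNum e0).
  have /cvgrPdist_lt/(_ _ se0)[M _ HM] := hlim.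
  exists (maxn N M); split; first exact: HN (leq_maxl _ _).
  rewrite -dnorm_sqr; last exact: hsub.
  have := HM _ (leq_maxr N M).
  rewrite /= sub0r normrN ger0_norm ?sqrtr_ge0// => hM.
  by rewrite -[ltRHS](sqr_sqrtr (ltW e0)) ltr_pXn2r ?nnegrE ?sqrtr_ge0.
have hg : h = g.
  apply/funext => x; have [xu|xu] := boolP (in_unit x); last first.
    by rewrite g_supp// (rkhs_supp rk).
  have hK : H (K x) by exact: (rkhs_kernel rk).
  set k := dot (K x) (K x); have k0 : 0 <= k := rkhs_dot_ge0 hK.
  apply/eqP; rewrite -subr_eq0 -sqrf_eq0 eq_le sqr_ge0 andbT.
  apply/ler_addgt0Pr => e e0; rewrite add0r.
  have d0 : 0 < e / (4 * (k + 1)) by rewrite divr_gt0// mulr_gt0//; lra.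
  have [n [n1 n2]] := small _ d0.
  have [vn Jn] := hu n.
  have cs : (v n x - h x) ^+ 2 <= k * dot (v n \- h) (v n \- h).
    have := rkhs_CauchySchwarz (hsub _ _ (hv n) hh) hK.
    by rewrite (rkhs_reproducing rk)//; exact: hsub.
  (* Moving from [u n] along [K x] cannot lower [J] below its infimum. *)
  have st : (v n x - g x) ^+ 2 <= k * (J (u n) - inf Jset).
    have vx : kvalid [:: (1, x)] by rewrite /kvalid /= xu.
    have kx : kspan [:: (1, x)] = K x.
      by apply/funext => y; rewrite /kspan big_seq1 mul1r.
    have px : kpair g [:: (1, x)] = g x by rewrite /kpair big_seq1 mul1r.
    apply: quadratic_ge0 => // [|t]; first by rewrite subr_ge0 Jge.
    have := Jge (kvalid_lin t vx vn); rewrite J_lin// kx px.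
    by rewrite -/(v n) (rkhs_reproducing rk (hv n) xu) -/k; lra.
  have le1 : k * dot (v n \- h) (v n \- h) <= k * (e / (4 * (k + 1))).
    by apply: ler_wpM2l => //; exact: ltW.
  have le2 : k * (J (u n) - inf Jset) <= k * (e / (4 * (k + 1))).
    apply: ler_wpM2l => //; rewrite lerBlDl; apply/ltW/(lt_trans Jn).
    by rewrite ltrD2l.
  have le3 : k * (e / (4 * (k + 1))) <= e / 4.
    rewrite mulrA ler_pdivrMr; last by lra.
    rewrite (_ : e / 4 * (4 * (k + 1)) = e * (k + 1)); last by field.
    by rewrite mulrC ler_pM2l//; lra.
  have : (h x - g x) ^+ 2 <= 2 * (v n x - h x) ^+ 2 + 2 * (v n x - g x) ^+ 2.
    by have := sqr_ge0 ((v n x - h x) + (v n x - g x)); lra.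
  by lra.
split; first by rewrite -hg.
apply/ler_addgt0Pr => e e0; have [n [_]] := small e e0.
have [vn _] := hu n; have := g_bound vn.
have dh : dot (v n) h = kpair g (u n) by rewrite -hg; exact: dot_kspan.
rewrite dsub// -/(v n) dh hg; set x := dot g g; set y := kpair _ _.
by set z := dot _ _; lra.
Qed.

End riesz.

(** The Gram matrices of the kernel dominate those of each truncation of its
    Mercer expansion, and [2 * a k * L <= a k ^+ 2 / mu k + mu k * L ^+ 2] for
    each eigenfunction then bounds the functional attached to the combination.
    The function is cut off outside the unit interval, where the elements of the
    space vanish and the eigenfunctions are arbitrary. *)
Lemma mercer_unit_ball mu psi nu (a : 'I_nu -> R) :
  mercer_expansion K mu psi -> (forall k, (k < nu)%N -> 0 < mu k) ->
  \sum_(k < nu) a k ^+ 2 / mu k <= 1 ->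
  let g := fun x => if in_unit x then \sum_(k < nu) a k * psi k x else 0 in
  H g /\ dnorm dot g <= 1.
Proof.
move=> [_ mu0 _ KE] mupos a1 g.
have [|s vs|Hg g1] := @rkhs_unit_ball g.
- by move=> x; rewrite /g => /negbTE ->.
- pose L k := \sum_(q <- s) q.1 * psi k q.2.
  have sU q : q \in s -> in_unit q.2 by move: vs => /allP; exact.
  have gE : kpair g s = \sum_(k < nu) a k * L k.
    rewrite /kpair big_seq.
    under eq_bigr => q qs do rewrite /g (sU q qs) mulr_sumr.
    rewrite -big_seq exchange_big/=; apply: eq_bigr => k _.
    by rewrite mulr_sumr; apply: eq_bigr => q _; rewrite mulrCA.
  have cvgL : (fun N => \sum_(0 <= k < N) mu k * L k ^+ 2) @ \oo -->
      dot (kspan s) (kspan s).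
    have -> : dot (kspan s) (kspan s) = \sum_(q <- s | q \in s)
        \sum_(r <- s | r \in s) q.1 * (r.1 * K r.2 q.2).
      rewrite dot_kspan//; last exact: rkhs_kspan.
      rewrite /kpair big_seq; apply: eq_bigr => q _.
      by rewrite /kspan big_seq mulr_sumr.
    rewrite (_ : (fun N => _) = (fun N => \sum_(q <- s | q \in s)
        \sum_(r <- s | r \in s)
        q.1 * (r.1 * series (fun k => mu k * psi k r.2 * psi k q.2) N))).
      apply: cvg_big => [|q qs]; first exact: add_continuous.
      apply: cvg_big => [|r rs]; first exact: add_continuous.
      by apply: cvgMr => //; apply: cvgMr => //; apply: KE; apply: sU.
    apply/funext => N; rewrite /series/=.
    under [RHS]eq_bigr do under eq_bigr do rewrite mulr_sumr mulr_sumr.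
    under [RHS]eq_bigr do rewrite exchange_big/=.
    rewrite [RHS]exchange_big/=; apply: eq_bigr => k _.
    rewrite expr2 /L big_seq big_distrlr/= mulr_sumr; apply: eq_bigr => q _.
    by rewrite mulr_sumr; apply: eq_bigr => r _; ring.
  have geL : \sum_(k < nu) mu k * L k ^+ 2 <= dot (kspan s) (kspan s).
    rewrite -(cvg_lim _ cvgL)//; apply: limr_ge.
      by apply/cvg_ex; eexists; exact: cvgL.
    exists nu => // N /= nuN.
    rewrite -(big_mkord predT (fun k => mu k * L k ^+ 2)).
    rewrite (big_cat_nat _ nuN)//= lerDl sumr_ge0// => k _.
    by rewrite mulr_ge0// sqr_ge0.
  rewrite gE mulr_sumr; apply: le_trans (lerD a1 geL).
  rewrite -big_split/=; apply: ler_sum => k _.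
  have mk := mupos k (ltn_ord k).
  rewrite -subr_ge0 (_ : _ - _ = (a k - mu k * L k) ^+ 2 / mu k).
    by rewrite divr_ge0 ?sqr_ge0// ltW.
  by field; rewrite gt_eqF.
- split => //; rewrite -(@ler_pXn2r _ 2)// ?nnegrE ?sqrtr_ge0//.
  by rewrite dnorm_sqr// expr1n.
Qed.

End rkhs_membership.

(** * Sparse additive signals and the lower bound *)

Section square_integrable_extra.
Context d (T : measurableType d) (R : realType)
  (mu : {measure set T -> \bar R}).

Lemma Lnorm2_dot2 (f : T -> R) : sq_integrable mu f ->
  ('N[mu]_(2%:E)[EFin \o f] = (Num.sqrt (dot2 mu f f))%:E)%E.
Proof.
move=> hf; rewrite unlock.
under eq_integral => x _.
  rewrite /= powR_mulrn// real_normK ?num_real// expr2.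
  over.
have ff := integrable_fin_num measurableT (sq_integrableM hf hf).
by rewrite -(fineK ff) poweR_EFin -powR12_sqrt ?dot2_ge0//.
Qed.

End square_integrable_extra.

Section coordinate_functions.
Context (R : realType) (p : nat).
Local Notation cube := (unit_cube_leb R p).
Local Notation leb1 := (unit_leb R).

Lemma sq_integrable_cst1 : sq_integrable leb1 (fun=> 1).
Proof. by split => //; exact: finite_measure_integrable_cst. Qed.

Lemma prod_if (g : 'I_p -> R) (j : 'I_p) :
  \prod_(l < p) (if l == j then g l else 1) = g j.
Proof. by rewrite -big_mkcond/= big_pred1_eq. Qed.

Lemma sq_integrable_coord (g : R -> R) (j : 'I_p) : sq_integrable leb1 g ->
  sq_integrable cube (fun x => g (tnth x j)).
Proof.
move=> hg; split.
  by apply: (measurableT_comp hg.1); exact: measurable_tnth.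
have [] := @integral_power_prob_prod _ _ R leb1 p
  (fun l u => if l == j then g u ^+ 2 else 1) => [l|+ _].
  by case: eqP => _; [exact: hg.2|exact: finite_measure_integrable_cst].
congr integrable; apply/funext => x.
by rewrite (prod_if (fun l => g (tnth x l) ^+ 2)).
Qed.

(** Coordinates are independent, and the integral of [g] vanishes. *)
Lemma dot2_coord (g h : R -> R) (i j : 'I_p) :
  sq_integrable leb1 g -> sq_integrable leb1 h ->
  dot2 leb1 g (fun=> 1) = 0 ->
  dot2 cube (fun x => g (tnth x i)) (fun x => h (tnth x j)) =
  (i == j)%:R * dot2 leb1 g h.
Proof.
move=> hg hh g0.
pose G (l : 'I_p) u :=
  (if l == i then g u else 1) * (if l == j then h u else 1).
have iG l : leb1.-integrable setT (EFin \o G l).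
  have s1 : sq_integrable leb1 (fun u => if l == i then g u else 1).
    by case: eqP => _ //; exact: sq_integrable_cst1.
  have s2 : sq_integrable leb1 (fun u => if l == j then h u else 1).
    by case: eqP => _ //; exact: sq_integrable_cst1.
  exact: sq_integrableM s1 s2.
have [_ E] := integral_power_prob_prod iG.
have -> : dot2 cube (fun x => g (tnth x i)) (fun x => h (tnth x j)) =
    \int[power_prob leb1 p]_z \prod_(l < p) G l (tnth z l).
  apply: eq_Rintegral => x _; rewrite /G big_split/=.
  by rewrite (prod_if (fun l => g (tnth x l)))
    (prod_if (fun l => h (tnth x l))).
rewrite E (bigD1 i)//= /G eqxx; have [<-|ij] := eqVneq i j.
  rewrite big1 ?mulr1 ?mul1r// => l /negbTE li.
  under eq_Rintegral do rewrite li mulr1.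
  rewrite Rintegral_cst// mul1r.
  exact: (congr1 fine (probability_setT leb1)).
by rewrite mul0r -/(dot2 leb1 g (fun=> 1)) g0 mul0r.
Qed.

(** Elements of the reproducing kernel Hilbert space vanish outside the unit
    interval; eigenfunctions have to be cut off there. *)
Definition zero_ext (g : R -> R) (x : R) : R := if in_unit x then g x else 0.

Lemma sq_integrable_zero_ext g : sq_integrable leb1 g ->
  sq_integrable leb1 (zero_ext g).
Proof.
move=> [mg ig].
have zE : zero_ext g = (fun x => g x * \1_(`[0, 1]%classic : set R) x).
  apply/funext => x; rewrite /zero_ext indicE mem_setE in_itv/= /in_unit.
  by case: ifP; rewrite ?mulr1 ?mulr0.
have mz : measurable_fun setT (zero_ext g).
  by rewrite zE; apply: measurable_funM => //; exact: measurable_indic.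
split => //; apply: le_integrable ig => //.
- by apply/measurable_EFinP; exact: measurable_funX.
- move=> x _; rewrite !abse_EFin lee_fin /zero_ext; case: ifP => // _.
  by rewrite expr0n/= normr0.
Qed.

Lemma dot2_zero_ext g h : sq_integrable leb1 g -> sq_integrable leb1 h ->
  dot2 leb1 (zero_ext g) (zero_ext h) = dot2 leb1 g h.
Proof.
move=> hg hh; congr fine.
have hg' := sq_integrable_zero_ext hg; have hh' := sq_integrable_zero_ext hh.
apply: ae_eq_integral => //.
- exact: measurable_int (sq_integrableM hg' hh').
- exact: measurable_int (sq_integrableM hg hh).
exists (~` `[0, 1]%classic); split.
- exact: measurableC.
- rewrite /unit_leb /= /uniform_prob integral_uniform_pdf setICl.
  by rewrite integral_set0.
- move=> x /= nE; rewrite in_itv/= => x01; apply: nE => _.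
  by rewrite /zero_ext /in_unit x01.
Qed.

End coordinate_functions.

Section prior_signals.
Context (R : realType) (p s m nu : nat) (alpha : R) (psi : nat -> R -> R).
Hypothesis smp : (s * m <= p)%N.
Local Notation cube := (unit_cube_leb R p).
Local Notation leb1 := (unit_leb R).
Hypothesis psi_sq : forall k, sq_integrable leb1 (psi k).
Hypothesis psi_dot : forall j k, dot2 leb1 (psi j) (psi k) = (j == k)%:R.
Hypothesis psi_centered : forall k, (k < nu)%N ->
  dot2 leb1 (zero_ext (psi k)) (fun=> 1) = 0.

Lemma block_coord_proof (b : 'I_s) (i : 'I_m) : (b * m + i < p)%N.
Proof.
apply: leq_trans smp; apply: (@leq_trans (b.+1 * m)); last first.
  by rewrite leq_mul2r ltn_ord orbT.
by rewrite mulSn addnC ltn_add2r.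
Qed.

Definition block_coord b i : 'I_p := Ordinal (block_coord_proof b i).

Lemma block_coord_inj b b' i i' :
  (block_coord b i == block_coord b' i') = (b == b') && (i == i').
Proof.
apply/eqP/andP => [/(congr1 val) /= E|[/eqP-> /eqP->]//].
have m0 : (0 < m)%N by apply: leq_ltn_trans (ltn_ord i).
have : ((b * m + i) %/ m = (b' * m + i') %/ m)%N by rewrite E.
rewrite !divnMDl// !divn_small// !addn0 => bb.
split; apply/eqP/val_inj => //=.
by apply: (@addnI (b * m)%N); rewrite [in RHS]bb.
Qed.

Definition active (w : config s m nu) b : 'I_p := block_coord b (w b).1.

Definition block_fun (w : config s m nu) (b : 'I_s) (x : R) : R :=
  \sum_(k < nu) (alpha * (-1) ^+ (w b).2 k) * zero_ext (psi k) x.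

Definition signal (w : config s m nu) (x : p.-tuple R) : R :=
  \sum_(b < s) block_fun w b (tnth x (active w b)).

Lemma active_inj w : injective (active w).
Proof. by move=> b b' /eqP; rewrite block_coord_inj => /andP[/eqP]. Qed.

Lemma sq_integrable_block_fun w b : sq_integrable leb1 (block_fun w b).
Proof.
apply: sq_integrable_sum => k _; apply: sq_integrableZ.
exact: sq_integrable_zero_ext.
Qed.

Lemma sq_integrable_signal w : sq_integrable cube (signal w).
Proof.
apply: sq_integrable_sum => b _.
exact: sq_integrable_coord (sq_integrable_block_fun w b).
Qed.

Lemma dot2_signal w w' :
  dot2 cube (signal w) (signal w') = alpha ^+ 2 * config_dot R w w'.
Proof.
have hz k := sq_integrable_zero_ext (psi_sq k).
have hb v b := sq_integrable_coord (active v b) (sq_integrable_block_fun v b).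
have b0 v b : dot2 leb1 (block_fun v b) (fun=> 1) = 0.
  rewrite dot2_suml//; last exact: sq_integrable_cst1.
  by rewrite big1// => k _; rewrite psi_centered// mulr0.
have sE v : signal v =
    (fun x => \sum_(b < s) 1 * block_fun v b (tnth x (active v b))).
  by apply/funext => x; apply: eq_bigr => b _; rewrite mul1r.
rewrite sE dot2_suml//; last exact: sq_integrable_signal.
rewrite /config_dot mulr_sumr; apply: eq_bigr => b _; rewrite mul1r.
rewrite sE dot2_sumr// (bigD1 b)//= big1 ?addr0 => [|b' bb']; last first.
  rewrite dot2_coord//; try exact: sq_integrable_block_fun.
  by rewrite block_coord_inj eq_sym (negbTE bb') mul0r mulr0.
rewrite mul1r dot2_coord//; try exact: sq_integrable_block_fun.
rewrite block_coord_inj eqxx /= /block_dot mulrCA; congr (_ * _).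
rewrite dot2_suml//; last exact: sq_integrable_block_fun.
rewrite mulr_sumr; apply: eq_bigr => k _.
rewrite dot2_sumr// (bigD1 k)//= big1 ?addr0 => [|k' kk']; last first.
  by rewrite dot2_zero_ext// psi_dot eq_sym val_eqE (negbTE kk') mulr0.
by rewrite dot2_zero_ext// psi_dot eqxx mulr1 mulrACA -expr2.
Qed.

Lemma config_dot_diag (w : config s m nu) : config_dot R w w = s%:R * nu%:R.
Proof.
rewrite /config_dot (eq_bigr (fun=> nu%:R)).
  by rewrite sumr_const card_ord mulr_natl.
move=> b _; rewrite /block_dot eqxx mul1r (eq_bigr (fun=> 1)).
  by rewrite sumr_const card_ord.
by move=> k _; rewrite -expr2 sqrr_sign.
Qed.

Lemma Lnorm_signal w :
  ('N[cube]_(2%:E)[EFin \o signal w] =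
   (Num.sqrt (alpha ^+ 2 * (s%:R * nu%:R)))%:E)%E.
Proof.
rewrite Lnorm2_dot2 ?dot2_signal ?config_dot_diag//.
exact: sq_integrable_signal.
Qed.

Lemma signal_sparse H0 dot w :
  (forall b, H0 (block_fun w b) /\ dnorm dot (block_fun w b) <= 1) ->
  sparse_additive_class H0 dot s (signal w).
Proof.
move=> hb; exists [set active w b | b in 'I_s]%SET.
  by rewrite /= (leq_trans (leq_imset_card _ _))// card_ord.
(* The component at [j] is a sum with one term, that of the block of [j]. *)
exists (fun j x => \sum_(b < s | active w b == j) block_fun w b x).
  move=> _ /imsetP[b _ ->].
  rewrite (_ : (fun x => _) = block_fun w b) //.
  apply/funext => x; rewrite (big_pred1 b)// => b' /=.
  by rewrite (inj_eq (@active_inj w)).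
apply/funext => x; rewrite /signal.
rewrite (partition_big (active w)
  (mem [set active w b | b in 'I_s]%SET))/=; last first.
  by move=> b _; exact: imset_f.
by apply: eq_bigr => j _; apply: eq_bigr => b /eqP <-.
Qed.

End prior_signals.

Section lower_bound.
Context (R : realType) (eta : R) (p n s : nat).
Hypothesis eta01 : 0 < eta < 1.
Hypothesis s_ge1 : (1 <= s)%N.
Hypothesis s_le_p : (s <= p)%N.
Hypothesis n_gt0 : (0 < n)%N.
Context (H0 : set (R -> R)) (dot : (R -> R) -> (R -> R) -> R)
  (K0 : R -> R -> R) (H0_rkhs : is_rkhs H0 dot K0)
  (H0_centered : forall h, H0 h -> L2dot h (fun=> 1) = 0)
  (mu : nat -> R) (psi : nat -> R -> R) (K0_mercer : mercer_expansion K0 mu psi)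
  (d : measure_display) (Omega : measurableType d)
  (P : probability Omega R) (B : p.-tuple R -> Omega -> R)
  (B_sheet : brownian_sheet P B).

Let psi_sq k : sq_integrable (unit_leb R) (psi k).
Proof.
have [[hL _] _ _ _] := K0_mercer; split; last first.
  exact: Lfun2_integrable_sqr (hL k).
by have := hL k; rewrite inE => /andP[]; rewrite inE.
Qed.

Let psi_dot j k : dot2 (unit_leb R) (psi j) (psi k) = (j == k)%:R.
Proof. by have [[_ hO] _ _ _] := K0_mercer; exact: hO. Qed.

(** [sqrt (mu k) * psi k] is in the unit ball of the space of centered
    functions. *)
Let zero_ext_centered k : 0 < mu k ->
  dot2 (unit_leb R) (zero_ext (psi k)) (fun=> 1) = 0.
Proof.
move=> mk; have mpos j : (j < k.+1)%N -> 0 < mu j.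
  rewrite ltnS => jk; apply: lt_le_trans mk _.
  have [_ _ dec _] := K0_mercer.
  rewrite -(subnK jk); elim: (k - j)%N => // l IH.
  exact: le_trans (dec _) IH.
pose a (j : 'I_k.+1) := if j == ord_max then Num.sqrt (mu k) else 0.
have sum_a : \sum_(j < k.+1) a j ^+ 2 / mu j <= 1.
  rewrite big_ord_recr/= big1 ?add0r => [|j _].
    by rewrite /a eqxx sqr_sqrtr ?(ltW mk)// divff// lt0r_neq0.
  by rewrite /a -val_eqE/= ltn_eqF// expr0n mul0r.
have [/H0_centered h0 _] := mercer_unit_ball H0_rkhs K0_mercer mpos sum_a.
have smk : Num.sqrt (mu k) != 0 by rewrite gt_eqF// sqrtr_gt0.
apply: (mulfI smk); rewrite mulr0 -[RHS]h0 /L2dot /dot2.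
rewrite -RintegralZl//; last first.
  exact: (sq_integrableM (sq_integrable_zero_ext (psi_sq k))
    (sq_integrable_cst1 R)).
apply: eq_Rintegral => x _; rewrite /zero_ext; case: ifP => _; last first.
  by rewrite !mul0r mulr0.
rewrite big_ord_recr/= big1 ?add0r => [|j _].
  by rewrite /a eqxx mulrA.
by rewrite /a -val_eqE/= ltn_eqF// mul0r.
Qed.

(** The bound obtained from [nu] coefficients of size [alpha] on each active
    coordinate.  The hypotheses on [mu] put the signals in the class, those on
    [lam] make them undetectable, and the last one gives them the required
    norm. *)
Lemma prior_lower_bound (nu : nat) (alpha lam c : R) :
  (forall k, (k < nu)%N -> 0 < mu k) ->
  \sum_(k < nu) alpha ^+ 2 / mu k <= 1 ->
  ((expR (n%:R * alpha ^+ 2) + expR (- (n%:R * alpha ^+ 2))) / 2) ^+ nu <=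
    expR lam ->
  lam <= eta ^+ 2 / 4 * log_term R p s ->
  0 < c -> c ^+ 2 * rate_sq mu p s n <= alpha ^+ 2 * (s%:R * nu%:R) ->
  ((1 - eta)%:E <= minimax_testing_risk P B n
     [set f | sparse_additive_class H0 dot s f /\
        (c * rate mu p s n)%:E <= 'N[unit_cube_leb R p]_(2%:E)[EFin \o f]])%E.
Proof.
move=> mpos ha hlam lamle c0 hrate.
pose m := (p %/ s)%N.
have m0 : (0 < m)%N by rewrite divn_gt0.
have smp : (s * m <= p)%N by rewrite mulnC leq_trunc_div.
have psm : (p <= 2 * s * m)%N.
  rewrite {1}(divn_eq p s) -/m (@leq_trans (m * s + s))//.
    by rewrite leq_add2l ltnW// ltn_mod.
  by rewrite -mulnA mul2n -addnn [(s * m)%N]mulnC leq_add2l leq_pmull.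
have centered k : (k < nu)%N ->
    dot2 (unit_leb R) (zero_ext (psi k)) (fun=> 1) = 0.
  by move=> knu; apply: zero_ext_centered; exact: mpos.
have eta0 : 0 < eta by case/andP: eta01.
have card0 : (0 < #|{: config s m nu}|)%N.
  by rewrite -(ltr0n R) card_config exprn_gt0// mulr_gt0 ?ltr0n// exprn_gt0.
apply: (@minimax_testing_risk_ge _ _ _ _ _ P B B_sheet n_gt0 _
  (fun w : config s m nu => signal alpha psi smp w)) => //.
- by move=> w; exact: sq_integrable_signal.
- move=> w; split.
    apply: signal_sparse => b.
    have := @mercer_unit_ball _ _ _ _ H0_rkhs mu psi nu
      (fun k => alpha * (-1) ^+ (w b).2 k) K0_mercer mpos.
    rewrite /= (_ : (fun x => _) = block_fun alpha psi w b); last first.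
      apply/funext => x; rewrite /block_fun /zero_ext; case: ifP => _ //.
      by rewrite big1// => k _; rewrite mulr0.
    apply; apply: le_trans ha; apply: ler_sum => k _.
    by rewrite exprMn sqrr_sign mulr1.
  rewrite Lnorm_signal// lee_fin /rate.
  have -> : c = Num.sqrt (c ^+ 2) by rewrite sqrtr_sqr gtr0_norm.
  by rewrite -sqrtrM ?sqr_ge0// ler_wsqrtr.
- rewrite [#|_|%:R ^+ 2]expr2 [leRHS]mulrA.
  apply: (@le_trans _ _ (\sum_(w : config s m nu)
      (1 + eta ^+ 2) * #|{: config s m nu}|%:R)).
    apply: ler_sum => w _.
    under eq_bigr do rewrite dot2_signal// mulrA.
    exact: (sum_expR_config_le eta01 s_ge1 m0 psm hlam lamle w).
  by rewrite sumr_const -[leLHS]mulr_natr.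
Qed.

End lower_bound.

Theorem theorem1 (R : realType) (eta : R) (eta_gt0 : 0 < eta)
    (eta_lt1 : eta < 1) :
  exists2 c_eta : R, 0 < c_eta &
  forall (p n s : nat) (s_ge1 : (1 <= s)%N) (s_le_p : (s <= p)%N)
    (log_le : log_term R p s <= n%:R / 2)
    (* the RKHS H and the RKHS of its centered elements *)
    (H : set (R -> R)) (dot : (R -> R) -> (R -> R) -> R) (K : R -> R -> R)
    (H_rkhs : is_rkhs H dot K)
    (H_L2 : forall h, H h -> h \in Lfun (unit_leb R) 2%:E)
    (K_mercer : exists lambda phi, mercer_expansion K lambda phi)
    (K0 : R -> R -> R) (H0_rkhs : is_rkhs (centered H) dot K0)
    (mu : nat -> R) (psi : nat -> R -> R)
    (K0_mercer : mercer_expansion K0 mu psi) (mu_first : mu 0%N = 1)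
    (* the white noise *)
    (d : measure_display) (Omega : measurableType d)
    (P : probability Omega R) (B : p.-tuple R -> Omega -> R)
    (B_sheet : brownian_sheet P B)
    (c : R) (c_gt0 : 0 < c) (c_lt : c < c_eta),
  ((1 - eta)%:E <=
   minimax_testing_risk P B n
     [set f | sparse_additive_class (centered H) dot s f /\
              (c * rate mu p s n)%:E <=
                'N[unit_cube_leb R p]_(2%:E)[EFin \o f]])%E.
Proof.
(* Then [2 * c ^+ 2 <= 1] puts the signals in the class, and both [c ^+ 2] and
   [8 * c ^+ 4] are below the [eta ^+ 2 / 4] required by the second moment. *)
exists (eta ^+ 2 / 8) => [|p n s s_ge1 s_le_p log_le H dot K H_rkhs H_L2
  K_mercer K0 H0_rkhs mu psi K0_mercer mu_first d Omega P B B_sheet c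
  c_gt0 c_lt].
  by rewrite divr_gt0// exprn_gt0.
have eta01 : 0 < eta < 1 by rewrite eta_gt0.
have s0 : (0 : R) < s%:R by rewrite ltr0n.
have p0 : (0 : R) < p%:R by rewrite ltr0n; exact: leq_trans s_ge1 s_le_p.
have L0 : 0 < log_term R p s.
  by rewrite ln_gt0// ltrDl divr_gt0// exprn_gt0.
set L := log_term R p s in log_le L0.
have nR : (0 : R) < n%:R by move: (lt_le_trans L0 log_le); lra.
have n0 : (0 < n)%N by rewrite -(ltr0n R).
have e2 : 0 < eta ^+ 2 < 1 by apply/andP; split; nra.
have c8 : c < 1 / 8 by lra.
have c2 : c ^+ 2 <= eta ^+ 2 / 8 / 8 by nra.
have c20 : 0 < c ^+ 2 by rewrite exprn_gt0.
have [_ mu_ge0 mu_dec _] := K0_mercer.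
have mu_le i j : (i <= j)%N -> mu j <= mu i.
  move=> ij; rewrite -(subnK ij); elim: (j - i)%N => // l IH.
  exact: le_trans (mu_dec _) IH.
have mu_le1 k : mu k <= 1 by rewrite -mu_first; exact: mu_le.
have Hc h : centered H h -> L2dot h (fun=> 1) = 0 by case.
pose G := Gamma mu p s n.
(* Signals with [nu] coefficients, where [nu] attains half the supremum
   defining [Gamma]; the factor lost is absorbed by [c]. *)
have main_G : rate_sq mu p s n = s%:R * G ->
  ((1 - eta)%:E <= minimax_testing_risk P B n
     [set f | sparse_additive_class (centered H) dot s f /\
        (c * rate mu p s n)%:E <= 'N[unit_cube_leb R p]_(2%:E)[EFin \o f]])%E.
  move=> rateE.
  pose W k := Num.min (mu k) (Num.sqrt (k.+1%:R * L) / n%:R).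
  have W_sup : has_sup (range W).
    split; first by exists (W 0%N); exists 0%N.
    by exists 1 => _ [k _ <-]; rewrite /W ge_min mu_le1.
  have G0 : 0 < G.
    apply: (@lt_le_trans _ _ (W 0%N)); last first.
      by apply: sup_upper_bound => //; exists 0%N.
    by rewrite /W lt_min mu_first ltr01 divr_gt0// sqrtr_gt0 mul1r.
  have G2 : 0 < G / 2 by rewrite divr_gt0.
  have [_ [k _ <-] Wk] := sup_adherent G2 W_sup.
  have {Wk} : G / 2 < W k by move: Wk; rewrite -/G -[X in X - _]/G; lra.
  rewrite /W lt_min => /andP[Gmu Gk].
  pose nu := k.+1; have nu0 : (0 : R) < nu%:R by rewrite ltr0n.
  pose b := c ^+ 2 * G / nu%:R.
  have b0 : 0 < b by rewrite divr_gt0// mulr_gt0.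
  have sb : Num.sqrt b ^+ 2 = b by rewrite sqr_sqrtr// ltW.
  have nub : nu%:R * b = c ^+ 2 * G by rewrite /b mulrC divfK// lt0r_neq0.
  have mu0 : 0 < mu k by exact: lt_trans Gmu.
  apply: (@prior_lower_bound _ eta p n s eta01 s_ge1 s_le_p n0 _ _ _ H0_rkhs Hc
    mu psi K0_mercer d Omega P B B_sheet nu (Num.sqrt b)
    (nu%:R * (2 * (n%:R * b) ^+ 2)) c) => //; rewrite ?sb.
  - by move=> j jk; apply: lt_le_trans mu0 _; exact: mu_le.
  - apply: (@le_trans _ _ (\sum_(j < nu) b / mu k)).
      apply: ler_sum => j _; rewrite ler_pM2l// lef_pV2 ?posrE//.
        by apply: mu_le; rewrite -ltnS.
      by apply: lt_le_trans mu0 _; apply: mu_le; rewrite -ltnS.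
    rewrite sumr_const card_ord -mulr_natl mulrA nub ler_pdivrMr// mul1r.
    by nra.
  - rewrite (expRM_natl nu); apply: lerXn2r; rewrite ?nnegrE ?expR_ge0//.
    by apply: cosh_le_expR2; rewrite mulr_ge0 ?ltW.
  - rewrite (_ : nu%:R * _ =
      2 * c ^+ 2 ^+ 2 * ((n%:R * G) ^+ 2 / nu%:R)); last first.
      by rewrite /b; field; rewrite lt0r_neq0.
    have h : (n%:R * G) ^+ 2 / nu%:R <= 4 * L.
      have nuL : 0 <= nu%:R * L by rewrite mulr_ge0 ?ltW.
      rewrite ler_pdivrMr// mulrAC -mulrA.
      have hh : n%:R * G <= 2 * Num.sqrt (nu%:R * L).
        by move: Gk; rewrite ltr_pdivlMr//; lra.
      rewrite (_ : 4 * _ = (2 * Num.sqrt (nu%:R * L)) ^+ 2); last first.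
        by rewrite exprMn sqr_sqrtr//; ring.
      by apply: lerXn2r => //; rewrite nnegrE mulr_ge0 ?sqrtr_ge0 ?(ltW G0).
    apply: (@le_trans _ _ (2 * c ^+ 2 ^+ 2 * (4 * L))).
      by apply: ler_wpM2l => //; rewrite mulr_ge0// sqr_ge0.
    rewrite mulrA ler_pM2r//; nra.
  - rewrite rateE (_ : b * _ = s%:R * (nu%:R * b)); last by ring.
    by rewrite nub mulrCA.
have [/main_G //|rateE] : rate_sq mu p s n = s%:R * G \/
    rate_sq mu p s n = s%:R * L / n%:R.
  rewrite /rate_sq -/L -/G; case: ifP => _; last by left.
  by case: (leP (s%:R * L / n%:R)) => _; [left|right].
(* A single coefficient on each active coordinate. *)
pose b := c ^+ 2 * L / n%:R.
have b0 : 0 < b by rewrite divr_gt0// mulr_gt0.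
have sb : Num.sqrt b ^+ 2 = b by rewrite sqr_sqrtr// ltW.
have nb : n%:R * b = c ^+ 2 * L by rewrite /b mulrC divfK// lt0r_neq0.
apply: (@prior_lower_bound _ eta p n s eta01 s_ge1 s_le_p n0 _ _ _ H0_rkhs Hc
  mu psi K0_mercer d Omega P B B_sheet 1 (Num.sqrt b) (n%:R * b) c) => //;
  rewrite ?sb.
- by move=> [|//] _; rewrite mu_first.
- rewrite big_ord1 mu_first divr1 /b ler_pdivrMr// mul1r; nra.
- rewrite expr1; have nb0 : 0 <= n%:R * b by rewrite mulr_ge0 ?ltW.
  have : expR (- (n%:R * b)) <= expR (n%:R * b) by rewrite ler_expR; lra.
  lra.
- by rewrite nb -/L ler_pM2r//; lra.
- by rewrite rateE mulr1 le_eqVlt; apply/orP; left; apply/eqP; rewrite /b; ring.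
Qed.
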